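(* Suppose that the time-limited reachability Gramian $P_T$ exists and that the controls $u,\mathfrak u\in L^2([0,T];\mathbb R^m)$ satisfy $$\sum_{i=1}^\infty\Big(\exp\Big\{\int_0^T\|\mathfrak u(s)\|^2\,\mathrm ds\Big\}\Big)^{2i-1}\sum_{\tau\in\mathcal T_i}\int_{D(\tau;T)}\prod_{\ell\in\mathrm{leaves}(\tau)}\|u(t_\ell)\|^2\,\mathrm d(t_v)_{v\in\tau}<\infty.$$ Let $x_i$, $i\ge1$, be the solutions on $[0,T]$ of $$\dot x_1(t)=Ax_1(t)+Bu(t)+N(\mathfrak u(t)\otimes x_1(t)),\quad x_1(0)=0,$$ $$\dot x_i(t)=Ax_i(t)+N(\mathfrak u(t)\otimes x_i(t))+H\Big(\sum_{k=1}^{i-1}x_k(t)\otimes x_{i-k}(t)\Big),\quad x_i(0)=0,\quad i\ge2.$$ Then $x=\sum_{i=1}^\infty x_i$ is the unique global solution on $[0,T]$ of $$\dot x(t)=Ax(t)+Bu(t)+N(\mathfrak u(t)\otimes x(t))+H(x(t)\otimes x(t)),\quad x(0)=0.$$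
   Context: Setting: $n,m\in\mathbb N$, $T>0$, $A\in\mathbb R^{n\times n}$, $B\in\mathbb R^{n\times m}$, $N=[N_1\ \dots\ N_m]$, $H=[H_1\ \dots\ H_n]$ with $N_k,H_j\in\mathbb R^{n\times n}$; $\|\cdot\|$ is the Euclidean norm; $\otimes$ is the Kronecker product. Differential equations are understood in integrated form. Trees: $\mathcal T_1=\{\bullet\}$ and $\mathcal T_i=\{[\tau_1,\tau_2]:\tau_1\in\mathcal T_k,\tau_2\in\mathcal T_{i-k},k=1,\dots,i-1\}$, $i\ge2$, are the sets of full (ordered) binary rooted trees with $i$ leaves, where $[\tau_1,\tau_2]$ grafts $\tau_1,\tau_2$ onto a new common root. $|\tau|$ is the number of nodes, $\mathrm{leaves}(\tau)$ the set of nodes without children, $\mathrm{parent}(v)$ the parent of a non-root node $v$, and $D(\tau;t)=\{(t_v)_{v\in\tau}\in\mathbb R^{|\tau|}:0\le t_v\le t,\ t_v\le t_{\mathrm{parent}(v)}\text{ for every non-root node }v\}$. Gramian: let $\mathcal L(X)=AX+XA^\top+N(I\otimes X)N^\top=AX+XA^\top+\sum_{k=1}^mN_kXN_k^\top$. Let $Z_{1,T}$ solve $\dot Z_{1,T}(t)=\mathcal L(Z_{1,T}(t))$, $Z_{1,T}(0)=BB^\top$, and for $i\ge2$ let $\dot Z_{i,T}(t)=\mathcal L(Z_{i,T}(t))$, $Z_{i,T}(0)=H\big(\sum_{k=1}^{i-1}\int_0^TZ_{k,T}(s)\,\mathrm ds\otimes\int_0^TZ_{i-k,T}(s)\,\mathrm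 ds\big)H^\top$. Then $P_T:=\sum_{i=1}^\infty\int_0^TZ_{i,T}(s)\,\mathrm ds$, and $P_T$ ''exists'' if this series converges. *)

(* Defs.v *)
From HB Require Import structures.
From mathcomp Require Import all_boot all_order all_algebra zify.
From mathcomp Require Import mxtens.
From mathcomp Require Import all_classical all_reals all_analysis.

Set Implicit Arguments.
Unset Strict Implicit.
Unset Printing Implicit Defensive.

Import Order.TTheory GRing.Theory Num.Theory.
Import numFieldNormedType.Exports.

Local Open Scope classical_set_scope.
Local Open Scope ring_scope.

(** * Full ordered binary trees *)

Inductive tree : Type := Leaf | Graft of tree & tree.

Fixpoint gentree_of_tree (t : tree) : GenTree.tree unit :=
  if t is Graft l r then GenTree.Node 0 [:: gentree_of_tree l; gentree_of_tree r]
  else GenTree.Leaf tt.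

Fixpoint tree_of_gentree (g : GenTree.tree unit) : tree :=
  if g is GenTree.Node _ [:: l; r] then
    Graft (tree_of_gentree l) (tree_of_gentree r)
  else Leaf.

Lemma gentree_of_treeK : cancel gentree_of_tree tree_of_gentree.
Proof. by elim=> //= l -> r ->. Qed.

HB.instance Definition _ := Countable.copy tree (can_type gentree_of_treeK).

(* The trees with [i] leaves, for any [fuel >= i]. *)
Fixpoint trees_rec (fuel i : nat) : seq tree :=
  if fuel is fuel'.+1 then
    if i == 1%N then [:: Leaf] else
    flatten [seq [seq Graft t1 t2 | t1 <- trees_rec fuel' k,
                                    t2 <- trees_rec fuel' (i - k)]
            | k <- index_iota 1 i]
  else [::].

Definition trees (i : nat) : seq tree := trees_rec i i.

Lemma trees_rec_eq f g i :
  (i <= f)%N -> (i <= g)%N -> trees_rec f i = trees_rec g i.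
Proof.
elim: f g i => [|f IH] [|g] [|i] //= lif lig.
case: eqP => // _; congr flatten.
apply/eq_in_map => k; rewrite mem_index_iota => /andP[k0 ki].
rewrite (IH g k) ?(IH g (i.+1 - k)%N) //; lia.
Qed.

Lemma trees1 : trees 1 = [:: Leaf]. Proof. by []. Qed.

Lemma treesE i : (1 < i)%N ->
  trees i = flatten [seq [seq Graft t1 t2 | t1 <- trees k, t2 <- trees (i - k)]
                    | k <- index_iota 1 i].
Proof.
case: i => [//|i] i1; rewrite {1}/trees /= ifN ?gtn_eqF//; congr flatten.
apply/eq_in_map => k; rewrite mem_index_iota => /andP[k0 ki].
rewrite /trees (@trees_rec_eq i k k) ?(@trees_rec_eq i (i.+1 - k) (i.+1 - k))//;
  lia.
Qed.

Fixpoint nb_leaves (t : tree) : nat :=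
  if t is Graft l r then nb_leaves l + nb_leaves r else 1%N.

Lemma nb_leaves_gt0 t : (0 < nb_leaves t)%N.
Proof. by elim: t => //= l l0 r r0; lia. Qed.

Lemma mem_trees i t : (t \in trees i) = (nb_leaves t == i).
Proof.
elim: t i => [|l IHl r IHr] i /=.
  have [->//|[->//|i1]] : i = 1%N \/ i = 0%N \/ (1 < i)%N by lia.
  rewrite treesE// (ltn_eqF i1).
  by apply/negP => /flatten_mapP[k _ /allpairsP[[a b] []]].
have [l0 r0] := (nb_leaves_gt0 l, nb_leaves_gt0 r).
have [i1|i1] : (i <= 1)%N \/ (1 < i)%N by lia.
  have -> : (Graft l r \in trees i) = false by case: i i1 => [|[]].
  by apply/esym/eqP; lia.
rewrite treesE//; apply/flatten_mapP/eqP => [[k]|<-].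
  rewrite mem_index_iota => ki /allpairsP[[a b] /= [+ + [eql eqr]]].
  by rewrite -eql -eqr IHl IHr; lia.
exists (nb_leaves l); first by rewrite mem_index_iota; lia.
apply/allpairsP; exists (l, r); split=> //=; first by rewrite IHl.
by rewrite IHr; apply/eqP; lia.
Qed.

Lemma trees_uniq i : uniq (trees i).
Proof.
have [n] := ubnP i; elim: n i => // n IH i; rewrite ltnS => lin.
have [->//|[->//|i1]] : i = 1%N \/ i = 0%N \/ (1 < i)%N by lia.
rewrite treesE//.
have: uniq (index_iota 1 i) by exact: iota_uniq.
have: {subset index_iota 1 i <= index_iota 1 i} by [].
elim: {1 3 4}(index_iota 1 i) => //= k s IHs sub /andP[ks us].
rewrite cat_uniq IHs ?andbT//; last by move=> x xs; rewrite sub// inE xs orbT.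
have := sub k (mem_head _ _); rewrite mem_index_iota => ki.
apply/andP; split.
  apply: allpairs_uniq; [by apply: IH; lia|by apply: IH; lia|].
  by move=> [a b] [c d] _ _ /= [-> ->].
apply/hasPn => t /flatten_mapP[k' k's /allpairsP[[a b] /= [ak' _ ->]]].
apply/negP => /allpairsP[[c d] /= [ck _ [ac _]]].
move: ak' ck ks; rewrite ac !mem_trees => /eqP -> /eqP kk'.
by rewrite -kk' k's.
Qed.

(** * Nodes *)

(* A node is identified with the path that leads to it from the root [::];
   [false] and [true] mean going to the left and to the right child. *)
Definition node := seq bool.

Fixpoint nodes (t : tree) : seq node :=
  if t is Graft l r then
    [::] :: [seq false :: v | v <- nodes l] ++ [seq true :: v | v <- nodes r]
  else [:: [::]].

Definition nb_nodes (t : tree) : nat := size (nodes t).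

Definition parent (v : node) : node := if v is b :: w then belast b w else [::].

Definition leaves (t : tree) : seq node :=
  [seq v <- nodes t | ~~ has (fun w => (w != [::]) && (parent w == v)) (nodes t)].

(* The coordinate t_v of a point of R^|tau|. *)
Definition node_coord (R : realType) (t : tree) (p : (nb_nodes t).-tuple R) (v : node)
  : R := nth 0 p (index v (nodes t)).
Arguments node_coord {R} t p v.

Definition tree_domain (R : realType) (t : tree) (T : R)
  : set ((nb_nodes t).-tuple R) :=
  [set p | forall v, v \in nodes t ->
     [/\ 0 <= node_coord t p v, node_coord t p v <= T
       & v != [::] -> node_coord t p v <= node_coord t p (parent v)]].
Arguments tree_domain {R} t T.

(** * The Lebesgue measure on R^k *)

Lemma product_sigma_finite d1 d2 (T1 : measurableType d1)
    (T2 : measurableType d2) (R : realType)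
    (m1 : {sigma_finite_measure set T1 -> \bar R})
    (m2 : {sigma_finite_measure set T2 -> \bar R}) :
  sigma_finite setT (m1 \x m2)%E.
Proof.
have /sigma_finiteP[F [TF ndF Foo]] := sigma_finiteT m1.
have /sigma_finiteP[G [TG ndG Goo]] := sigma_finiteT m2.
exists (fun n => F n `*` G n).
  rewrite -setXTT TF TG predeqE => -[x y]; split.
    move=> [/= [n _ Fnx] [k _ Gky]]; exists (maxn n k) => //; split.
    - by move: x Fnx; exact/subsetPset/ndF/leq_maxl.
    - by move: y Gky; exact/subsetPset/ndG/leq_maxr.
  by move=> [n _ []/= ? ?]; split; exists n.
move=> k; have [? ?] := Foo k; have [? ?] := Goo k.
split; first exact: measurableX.
by rewrite product_measure1E// lte_mul_pinfty// ge0_fin_numE.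
Qed.

Section sigma_finite_of.
Context d (T : measurableType d) (R : realType).
Variables (mu : {measure set T -> \bar R}) (mu_sf : sigma_finite setT mu).
Definition sigma_finite_of of sigma_finite setT mu : set T -> \bar R := mu.
Let nu := sigma_finite_of mu_sf.
HB.instance Definition _ := Measure.on nu.
HB.instance Definition _ := @Measure_isSigmaFinite.Build _ _ _ nu mu_sf.
HB.instance Definition _ := SigmaFiniteMeasure.copy (sigma_finite_of mu_sf) nu.
End sigma_finite_of.

Section lebesgue_tuple.
Context {R : realType}.
Local Notation RT := (measurableTypeR R).

Definition tuple_cons k (p : RT * k.-tuple RT) : k.+1.-tuple RT :=
  [tuple of p.1 :: p.2].

Definition tuple_uncons k (p : k.+1.-tuple RT) : RT * k.-tuple RT :=
  (thead p, [tuple of behead p]).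

Lemma tuple_consK k : cancel (@tuple_cons k) (@tuple_uncons k).
Proof. by move=> [x p]; congr (_, _); apply: val_inj. Qed.

Lemma tuple_unconsK k : cancel (@tuple_uncons k) (@tuple_cons k).
Proof. by move=> p; rewrite /tuple_cons /= [RHS]tuple_eta. Qed.

Lemma measurable_tuple_cons k : measurable_fun [set: RT * k.-tuple RT] (@tuple_cons k).
Proof. exact: measurable_cons. Qed.

Lemma measurable_tuple_uncons k : measurable_fun [set: k.+1.-tuple RT] (@tuple_uncons k).
Proof.
by apply: measurable_fun_pair; [exact: measurable_tnth|exact: measurable_behead].
Qed.

Fixpoint lebesgue_tuple (k : nat) : set (k.-tuple RT) -> \bar R :=
  match k with
  | 0 => dirac ([tuple] : 0.-tuple RT)
  | k'.+1 => pushforward (lebesgue_measure \x @lebesgue_tuple k')%E (@tuple_cons k')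
  end.

Let is_sfm d (T : measurableType d) (mu : set T -> \bar R) :=
  exists nu : {sigma_finite_measure set T -> \bar R}, mu = nu.

Let lebesgue_tuple_sfm k : is_sfm (@lebesgue_tuple k).
Proof.
elim: k => [|k [nu IH]]; first by exists (dirac ([tuple] : 0.-tuple RT)).
rewrite /lebesgue_tuple -/lebesgue_tuple IH.
pose m : {measure set (k.+1.-tuple RT) -> \bar R} :=
  measure_function_pushforward__canonical__measure_function_Measure
    (@lebesgue_measure R \x nu)%E (@measurable_tuple_cons k).
have msf : sigma_finite setT m.
  have [F FT Foo] : sigma_finite setT (@lebesgue_measure R \x nu)%E.
    exact: product_sigma_finite.
  exists (fun i => @tuple_uncons k @^-1` F i).
    by rewrite -preimage_bigcup -FT preimage_setT.
  move=> i; have [mF Fi] := Foo i; split.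
    by rewrite -[X in measurable X]setTI; exact: measurable_tuple_uncons.
  rewrite /m/= /pushforward -comp_preimage.
  rewrite (_ : _ \o _ = id)//; apply/funext => x; exact: tuple_consK.
by exists (sigma_finite_of msf).
Qed.

Let lebesgue_tuple0 k : @lebesgue_tuple k set0 = 0%E.
Proof. by have [nu ->] := lebesgue_tuple_sfm k. Qed.

Let lebesgue_tuple_ge0 k A : (0 <= @lebesgue_tuple k A)%E.
Proof. by have [nu ->] := lebesgue_tuple_sfm k. Qed.

Let lebesgue_tuple_sigma_additive k : semi_sigma_additive (@lebesgue_tuple k).
Proof.
by have [nu ->] := lebesgue_tuple_sfm k; exact: measure_semi_sigma_additive.
Qed.

HB.instance Definition _ k := isMeasure.Build _ _ _ (@lebesgue_tuple k)
  (lebesgue_tuple0 k) (@lebesgue_tuple_ge0 k) (@lebesgue_tuple_sigma_additive k).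

Let lebesgue_tuple_sigma_finite k : sigma_finite setT (@lebesgue_tuple k).
Proof. by have [nu ->] := lebesgue_tuple_sfm k; exact: sigma_finiteT. Qed.

HB.instance Definition _ k := @Measure_isSigmaFinite.Build _ _ _
  (@lebesgue_tuple k) (@lebesgue_tuple_sigma_finite k).

Lemma lebesgue_tuple_box k (A : 'I_k -> set RT) :
  (forall i, measurable (A i)) ->
  lebesgue_tuple [set p : k.-tuple RT | forall i, A i (tnth p i)] =
    (\prod_(i < k) lebesgue_measure (A i))%E.
Proof.
elim: k A => [|k IH] A mA.
  by rewrite big_ord0 /= diracE mem_set//= => -[].
rewrite big_ord_recl /= /pushforward -IH// -product_measure1E//; last first.
  rewrite [X in measurable X](_ : _ =
    \bigcap_i ((@tnth _ RT ^~ i) @^-1` (A (lift ord0 i)) : set (k.-tuple RT))).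
    apply: fin_bigcap_measurable; first exact: finite_finset.
    by move=> i _; rewrite -[X in measurable X]setTI; exact: measurable_tnth.
  by apply/seteqP; split => p /= Ap i => [_|]; exact: Ap.
congr (_ _); apply/seteqP; split => -[x p] /= => [Ap|[A0 Ap] i].
  split; first exact: (Ap ord0).
  by move=> i; have := Ap (lift ord0 i); rewrite tnthS.
by case: (unliftP ord0 i) => [j|] ->; rewrite ?tnthS.
Qed.

End lebesgue_tuple.
Arguments lebesgue_tuple {R} k _.

(** * Vector- and matrix-valued functions of time *)

Definition enorm (R : realType) (k : nat) (v : 'cV[R]_k) : R :=
  Num.sqrt (\sum_(i < k) v i 0 ^+ 2).

Definition mx_integrable (R : realType) (p q : nat) (D : set R)
    (F : R -> 'M[R]_(p, q)) : Prop :=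
  forall i j, lebesgue_measure.-integrable D (EFin \o (fun s => F s i j)).

Definition mx_integral (R : realType) (p q : nat) (D : set R)
    (F : R -> 'M[R]_(p, q)) : 'M[R]_(p, q) :=
  \matrix_(i, j) \int[lebesgue_measure]_(s in D) F s i j.

(* [y] solves y'(t) = f(t, y(t)), y(0) = y0 on [0, T] in integrated form.  Such
   a [y] is automatically absolutely continuous on [0, T], since its integrand
   is required to be integrable. *)
Definition is_solution (R : realType) (p q : nat) (T : R)
    (f : R -> 'M[R]_(p, q) -> 'M[R]_(p, q)) (y0 : 'M[R]_(p, q))
    (y : R -> 'M[R]_(p, q)) : Prop :=
  mx_integrable `[0, T] (fun s => f s (y s)) /\
  forall t, 0 <= t <= T -> y t = y0 + mx_integral `[0, t] (fun s => f s (y s)).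

Definition is_L2 (R : realType) (k : nat) (T : R) (u : R -> 'cV[R]_k) : Prop :=
  (forall i, measurable_fun `[0, T] (fun s => u s i 0)) /\
  (\int[lebesgue_measure]_(s in `[0%R, T]) (enorm (u s) ^+ 2)%:E < +oo)%E.

(* Here and below, the block matrices N = [N_1 ... N_m] and H = [H_1 ... H_n]
   are plain matrices with m * n, resp. n * n, columns: [*t] orders the
   coordinates of u *t x so that N (u *t x) = \sum_k u_k N_k x. *)
Definition kron_cv (R : realType) (p q : nat) (a : 'cV[R]_p) (b : 'cV[R]_q)
  : 'cV[R]_(p * q) := a *t b.

(** * The time-limited reachability Gramian *)

Definition gramian_op (R : realType) (n m : nat) (A : 'M[R]_n)
    (N : 'M[R]_(n, m * n)) (X : 'M[R]_n) : 'M[R]_n :=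
  A *m X + X *m A^T + N *m ((1%:M : 'M[R]_m) *t X) *m N^T.

Definition gramian_family (R : realType) (n m : nat) (T : R) (A : 'M[R]_n)
    (B : 'M[R]_(n, m)) (N : 'M[R]_(n, m * n)) (H : 'M[R]_(n, n * n))
    (Z : nat -> R -> 'M[R]_n) : Prop :=
  is_solution T (fun _ => gramian_op A N) (B *m B^T) (Z 1%N) /\
  forall i, (2 <= i)%N ->
    is_solution T (fun _ => gramian_op A N)
      (H *m (\sum_(1 <= k < i)
               mx_integral `[0, T] (Z k) *t mx_integral `[0, T] (Z (i - k)%N))
         *m H^T)
      (Z i).

Definition is_gramian (R : realType) (n m : nat) (T : R) (A : 'M[R]_n)
    (B : 'M[R]_(n, m)) (N : 'M[R]_(n, m * n)) (H : 'M[R]_(n, n * n))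
    (P : 'M[R]_n) : Prop :=
  exists2 Z : nat -> R -> 'M[R]_n, gramian_family T A B N H Z &
    (fun k => \sum_(1 <= i < k) mx_integral `[0, T] (Z i)) @ \oo --> P.

(** * The bound on the controls *)

Definition tree_energy (R : realType) (m : nat) (T : R) (u : R -> 'cV[R]_m)
    (t : tree) : \bar R :=
  (\int[lebesgue_tuple (nb_nodes t)]_(p in tree_domain t T)
     (\prod_(l <- leaves t) enorm (u (node_coord t p l)) ^+ 2)%:E)%E.

Definition control_series (R : realType) (m : nat) (T : R)
    (u fu : R -> 'cV[R]_m) : \bar R :=
  (\sum_(1 <= i <oo)
     (expR (\int[lebesgue_measure]_(s in `[0, T]) (enorm (fu s) ^+ 2))
        ^+ (2 * i - 1))%:E
     * \sum_(t <- trees i) tree_energy T u t)%E.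

(* Main.v *)
Require Import Defs.
From mathcomp Require Import all_boot all_order all_algebra.
From mathcomp Require Import zify ring lra.
From mathcomp Require Import mxtens.
From mathcomp Require Import all_classical all_reals all_analysis.
From mathcomp Require Import measurable_realfun.

Set Implicit Arguments.
Unset Strict Implicit.
Unset Printing Implicit Defensive.

Import Order.TTheory GRing.Theory Num.Theory.
Import numFieldNormedType.Exports.

Local Open Scope classical_set_scope.
Local Open Scope ring_scope.

(** The heart of the proof is the inequality between quadratic forms
      x_i(t) x_i(t)^T <= c_i(t) P_i,    c_i(t) = E^(2i-1) e_i(t),
    where P_i is the integral of Z_i over [0, T], E = exp (int |fu|^2), and e_i(t)
    is the sum over the trees with i leaves of the integrals of the products of
    the |u|^2 over the tree domains bounded by t ([subsystem_estimate]).

    It makes everything summable: along the coordinate vectors, and with the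
    inequality between the arithmetic and the geometric mean, the sum of the
    absolute values of the entries of x_i(t) is at most n c_i(T) + tr P_i, and the
    series of both terms converge, by the hypotheses on the controls and on the
    Gramian.  Hence the series of the x_i converges normally, uniformly in time.
    Its partial sums solve the quadratic equation up to replacing the square by a
    partial Cauchy product, so that dominated convergence yields the equation for
    the sum ([series_solution]).  Two solutions agree by Gronwall's lemma
    ([full_solution_unique]).

    The inequality is proved by induction on i, because the three families follow
    the same recursion: splitting a tree at its root gives e_i' = sum_k e_k e_(i-k)
    ([trees_densityE]); the forcing term of x_i is H (sum_k x_k *t x_(i-k)); and
    Z_i starts from H (sum_k P_k *t P_(i-k)) H^T.  By the Cauchy-Schwarz inequality
    and [kron_dominated], the forcing term g of x_i satisfies g g^T <= rho G, with
    rho = sum_k c_k c_(i-k) and G the initial value of Z_i; for i = 1 this holds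
    with g = B u, rho = |u|^2 and G = B B^T.

    The inductive step is thus a statement about one linear equation
    y' = A y + N (fu *t y) + g, namely y y^T <= E (int rho) (int Z)
    ([forced_estimate]).  With W(t) the integral of Z over [0, t],
    r = eps + int rho and phi = int |fu|^2, the matrix D = exp(phi) r W - y y^T
    satisfies D' >= L D + (|fu|^2 + rho / r) D for the Gramian operator L, as one
    sees by completing two squares.  Such a differential
    inequality preserves positivity ([psd_flow]).

    Solutions are only absolutely continuous, so products and exponentials are
    differentiated in integrated form ([primitiveM], [primitive_expR]), by
    comparing increments over short intervals ([small_increments]).  The hypothesis
    on the controls enters through [tree_integral_le_energy], which bounds a
    recursively defined integral by the integral over the domain of the tree. *)

(** * Integrable functions and their primitives *)

Section primitive.
Context {R : realType}.
Local Notation mu := (@lebesgue_measure R).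
Implicit Types (T t : R) (f g F G : R -> R).

Definition L1 T f := mu.-integrable `[0, T] (EFin \o f).

(** Absolute continuity on [[0, T]], with the derivative as part of the data;
    [F] is not constrained outside of [[0, T]]. *)
Definition primitive T F f :=
  L1 T f /\ forall t, 0 <= t <= T -> F t = F 0 + \int[mu]_(s in `[0, t]) f s.

Lemma L1S T f t : t <= T -> L1 T f -> L1 t f.
Proof.
move=> tT; apply: integrableS => // x /=; rewrite !in_itv /= => /andP[-> /=].
by move=> /le_trans; apply.
Qed.

Lemma L1_measurable T f : L1 T f -> measurable_fun `[0, T] f.
Proof. by move=> /measurable_int /measurable_EFinP. Qed.

Lemma L1_integrableS T f s t : 0 <= s -> t <= T -> L1 T f ->
  mu.-integrable `[s, t] (EFin \o f).
Proof.
move=> s0 tT; apply: integrableS => // x /=; rewrite !in_itv /= => /andP[sx xt].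
by rewrite (le_trans s0 sx) (le_trans xt tT).
Qed.

Lemma L1_integrableSo T f s t : 0 <= s -> t <= T -> L1 T f ->
  mu.-integrable `]s, t] (EFin \o f).
Proof.
move=> s0 tT fi; apply: integrableS (L1_integrableS s0 tT fi) => //.
exact: subset_itv_oc_cc.
Qed.

Lemma L1_norm T f : L1 T f -> L1 T (fun s => `|f s|).
Proof. exact: integrable_norm. Qed.

Lemma L1D T f g : L1 T f -> L1 T g -> L1 T (fun s => f s + g s).
Proof. by move=> fi gi; exact: (integrableD _ fi gi). Qed.

Lemma L1Z T c f : L1 T f -> L1 T (fun s => c * f s).
Proof. by move=> fi; exact: (integrableZl _ c fi). Qed.

Lemma L1_cst T c : L1 T (fun=> c).
Proof.
rewrite /L1; apply: measurable_bounded_integrable => //.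
  by rewrite /= lebesgue_measure_itv; case: ifP => _; exact: ltry.
exists `|c|; split; first exact: num_real.
by move=> x cx y _; exact: ltW.
Qed.

Lemma L1_sum T (I : Type) (r : seq I) (P : pred I) (f : I -> R -> R) :
  (forall i, P i -> L1 T (f i)) -> L1 T (fun s => \sum_(i <- r | P i) f i s).
Proof.
move=> fi; elim: r => [|i r IH].
  under [X in L1 _ X]eq_fun do rewrite big_nil; exact: L1_cst.
under [X in L1 _ X]eq_fun do rewrite big_cons.
case: (boolP (P i)) => // Pi; apply: L1D => //; exact: fi.
Qed.

Lemma eq_L1 T f g : (forall t, 0 <= t <= T -> f t = g t) -> L1 T f -> L1 T g.
Proof.
move=> fg; apply: eq_integrable => // x /[!inE] /=; rewrite in_itv/= => xT.
by rewrite fg.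
Qed.

Lemma L1_le T f g : measurable_fun `[0, T] g ->
  (forall t, 0 <= t <= T -> `|g t| <= f t) -> L1 T f -> L1 T g.
Proof.
move=> mg gf fi; apply: le_integrable fi => //; first exact/measurable_EFinP.
move=> x; rewrite /= in_itv /= => xT; rewrite lee_fin (le_trans (gf _ xT))//.
exact: ler_norm.
Qed.

Lemma eq_itg f g t : (forall s, 0 <= s <= t -> f s = g s) ->
  \int[mu]_(s in `[0, t]) f s = \int[mu]_(s in `[0, t]) g s.
Proof.
by move=> fg; apply: eq_Rintegral => x; rewrite inE /= in_itv /=; exact: fg.
Qed.

Lemma itg0 f : \int[mu]_(s in `[0, 0]) f s = 0.
Proof. by rewrite set_itv1 Rintegral_set1. Qed.

Lemma itgD T f g : L1 T f -> L1 T g ->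
  \int[mu]_(s in `[0, T]) (f s + g s) =
  \int[mu]_(s in `[0, T]) f s + \int[mu]_(s in `[0, T]) g s.
Proof. by move=> fi gi; rewrite RintegralD. Qed.

Lemma itgZ T c f : L1 T f ->
  \int[mu]_(s in `[0, T]) (c * f s) = c * \int[mu]_(s in `[0, T]) f s.
Proof. by move=> fi; rewrite RintegralZl. Qed.

Lemma itg_sum T (I : Type) (r : seq I) (P : pred I) (f : I -> R -> R) :
  (forall i, P i -> L1 T (f i)) ->
  \int[mu]_(s in `[0, T]) (\sum_(i <- r | P i) f i s) =
  \sum_(i <- r | P i) \int[mu]_(s in `[0, T]) f i s.
Proof.
move=> fi; elim: r => [|i r IH].
  under eq_Rintegral do rewrite big_nil.
  by rewrite Rintegral_cst// mul0r big_nil.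
under eq_Rintegral do rewrite big_cons.
rewrite big_cons; case: (boolP (P i)) => // Pi.
by rewrite itgD ?IH//; [exact: fi|exact: L1_sum].
Qed.

Lemma itg_cst t c : 0 <= t -> \int[mu]_(s in `[0, t]) c = c * t.
Proof.
move=> t0; rewrite Rintegral_cst//= lebesgue_measure_itv/= lte_fin.
case: ltgtP t0 => [t0 _|//|<- _]; last by rewrite fine0.
by rewrite -EFinB /= subr0.
Qed.

Lemma itg_split T f s t : 0 <= s -> s <= t -> t <= T -> L1 T f ->
  \int[mu]_(x in `[0, t]) f x =
  \int[mu]_(x in `[0, s]) f x + \int[mu]_(x in `[s, t]) f x.
Proof.
move=> s0 st tT fi; rewrite -[X in _ = _ + X]Rintegral_itv_obnd_cbnd; last first.
  exact: L1_integrableSo fi.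
rewrite -(@Rintegral_itvB _ _ (BLeft 0)) ?bnd_simp//; last exact: L1S fi.
by rewrite addrC subrK.
Qed.

Lemma primitive_L1 T F f : primitive T F f -> L1 T f.
Proof. by case. Qed.

Lemma primitive_sub T F f s t : primitive T F f -> 0 <= s -> s <= t -> t <= T ->
  F t - F s = \int[mu]_(x in `[s, t]) f x.
Proof.
move=> [fi FE] s0 st tT.
rewrite (FE t) ?tT ?(le_trans s0)// (FE s) ?s0 ?(le_trans st)//.
by rewrite (itg_split s0 st tT fi) opprD addrACA subrr add0r addrAC subrr add0r.
Qed.

Lemma primitive_dist T F f s t : primitive T F f -> 0 <= s -> s <= t -> t <= T ->
  `|F t - F s| <= \int[mu]_(x in `[s, t]) `|f x|.
Proof.
move=> Ff s0 st tT; rewrite (primitive_sub Ff s0 st tT).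
by apply: le_normr_Rintegral => //; exact: L1_integrableS Ff.1.
Qed.

Lemma primitive_bounded T F f : primitive T F f ->
  exists M, forall t, 0 <= t <= T -> `|F t| <= M.
Proof.
move=> Ff; exists (`|F 0| + \int[mu]_(x in `[0, T]) `|f x|).
move=> t /andP[t0 tT]; rewrite -[F t](subrK (F 0)) addrC.
rewrite (le_trans (ler_normD _ _))// lerD2l.
apply: (le_trans (primitive_dist Ff (lexx _) t0 tT)).
rewrite (itg_split t0 tT (lexx _) (L1_norm Ff.1)) lerDl.
by apply: Rintegral_ge0 => x _.
Qed.

(** Absolute continuity of the integral of [`|f|]. *)
Lemma primitive_unif_cont T F f e : primitive T F f -> 0 < e ->
  exists2 d, 0 < d & forall s t, 0 <= s <= T -> 0 <= t <= T -> `|t - s| < d ->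
    `|F t - F s| < e.
Proof.
move=> Ff e0.
have fi : mu.-integrable setT (EFin \o (f \_ `[0, T])).
  rewrite -restrict_EFin; apply/(integrable_mkcond _ _).1 => //; exact: Ff.1.
have [d [d0 dP]] := integral_normr_continuous fi e0.
exists d => //.
have key s t : 0 <= s -> s <= t -> t <= T -> t - s < d -> `|F t - F s| < e.
  move=> s0 st tT tsd; apply: (le_lt_trans (primitive_dist Ff s0 st tT)).
  rewrite [ltLHS](_ : _ = \int[mu]_(x in `[s, t]) `|(f \_ `[0, T]) x|).
    apply: dP => //; rewrite /= lebesgue_measure_itv/= lte_fin.
    by case: ifP => _; rewrite ?lte_fin// -EFinB lte_fin.
  apply: eq_Rintegral => x; rewrite inE /= in_itv /= => /andP[sx xt].
  by rewrite patchE mem_set//= in_itv /= (le_trans s0 sx) (le_trans xt tT).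
move=> s t /andP[s0 sT] /andP[t0 tT].
have [st|/ltW ts] := leP s t; first by rewrite ger0_norm ?subr_ge0// => /key; apply.
by rewrite distrC ger0_norm ?subr_ge0// [X in _ -> X < _]distrC => /key; apply.
Qed.

Lemma primitive_measurable T F f : primitive T F f -> measurable_fun `[0, T] F.
Proof.
move=> Ff; have [T0|T0] := leP 0 T; last first.
  by rewrite set_itv_ge ?bnd_simp -?ltNge//; exact: measurable_fun_set0.
apply: (@eq_measurable_fun _ _ _ _ _
  (fun t => F 0 + \int[mu]_(s in `[0, t]) f s)).
  by move=> t; rewrite inE /= in_itv /= => tT; rewrite [RHS]Ff.2.
apply: measurable_funD => //.
apply: subspace_continuous_measurable_fun => //.
exact: parameterized_integral_continuous T0 Ff.1.
Qed.

(** Being bounded and measurable, a primitive is a multiplier of integrable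
    functions. *)
Lemma L1M T F f g : primitive T F f -> L1 T g -> L1 T (fun s => F s * g s).
Proof.
move=> Ff gi; have [M FM] := primitive_bounded Ff.
apply: (L1_le _ _ (L1Z M (L1_norm gi))).
  apply: measurable_funM; [exact: primitive_measurable Ff|exact: L1_measurable].
by move=> t tT; rewrite normrM ler_wpM2r// FM.
Qed.

Lemma primitive_L1l T F f : primitive T F f -> L1 T F.
Proof.
move=> Ff; apply: eq_L1 (L1M Ff (L1_cst T 1)) => t _; exact: mulr1.
Qed.

Lemma primitive_int T f :
  L1 T f -> primitive T (fun t => \int[mu]_(s in `[0, t]) f s) f.
Proof. by move=> fi; split=> // t tT; rewrite itg0 add0r. Qed.

Lemma primitive_cst T c : primitive T (fun=> c) (fun=> 0).
Proof. by split=> [|t _]; [exact: L1_cst|rewrite Rintegral_cst// mul0r addr0]. Qed.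

Lemma primitiveD T F G f g : primitive T F f -> primitive T G g ->
  primitive T (fun t => F t + G t) (fun t => f t + g t).
Proof.
move=> [fi FE] [gi GE]; split=> [|t tT]; first exact: L1D.
have /andP[_ tT'] := tT.
by rewrite (FE _ tT) (GE _ tT) addrACA itgD//; exact: L1S tT' _.
Qed.

Lemma primitiveZ T c F f : primitive T F f ->
  primitive T (fun t => c * F t) (fun t => c * f t).
Proof.
move=> [fi FE]; split=> [|t tT]; first exact: L1Z.
have /andP[_ tT'] := tT.
by rewrite (FE _ tT) itgZ ?mulrDr//; exact: L1S tT' _.
Qed.

Lemma eq_primitive T F G f g : (forall t, 0 <= t <= T -> F t = G t) ->
  (forall t, 0 <= t <= T -> f t = g t) -> primitive T F f -> primitive T G g.
Proof.
move=> FG fg [fi FE]; split; first exact: eq_L1 fi.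
move=> t tT; have /andP[t0 tT'] := tT.
rewrite -FG// -FG ?lexx ?(le_trans t0)// FE//; congr (_ + _).
by apply: eq_itg => s /andP[s0 st]; rewrite fg// s0 (le_trans st).
Qed.

Lemma primitiveB T F G f g : primitive T F f -> primitive T G g ->
  primitive T (fun t => F t - G t) (fun t => f t - g t).
Proof.
move=> Ff /(primitiveZ (-1)) /(primitiveD Ff).
by apply: eq_primitive => t _; rewrite mulN1r.
Qed.

Lemma primitive_sum T (I : Type) (r : seq I) (P : pred I) (F f : I -> R -> R) :
  (forall i, P i -> primitive T (F i) (f i)) ->
  primitive T (fun t => \sum_(i <- r | P i) F i t)
    (fun t => \sum_(i <- r | P i) f i t).
Proof.
move=> Ff; elim: r => [|i r IH].
  by apply: eq_primitive (primitive_cst T 0) => t _; rewrite big_nil.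
have [Pi|NPi] := boolP (P i).
  by apply: eq_primitive (primitiveD (Ff i Pi) IH) => t _; rewrite big_cons Pi.
by apply: eq_primitive IH => t _; rewrite big_cons (negbTE NPi).
Qed.

Lemma primitive_le T F f s t : primitive T F f ->
  (forall x, 0 <= x <= T -> 0 <= f x) ->
  0 <= s -> s <= t -> t <= T -> F s <= F t.
Proof.
move=> Ff f0 s0 st tT; rewrite -subr_ge0 (primitive_sub Ff s0 st tT).
apply: Rintegral_ge0 => x /=; rewrite in_itv /= => /andP[sx xt].
by apply: f0; rewrite (le_trans s0 sx) (le_trans xt tT).
Qed.

End primitive.

(** * Product rule, exponentials and Gronwall's lemma *)

Section calculus.
Context {R : realType}.
Local Notation mu := (@lebesgue_measure R).
Implicit Types (T t : R) (f g F G : R -> R).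

(** Stands in for subdivisions of [[0, T]]: what survives every short step holds
    throughout. *)
Lemma step_induction T (d : R) (P : R -> Prop) : 0 < d -> P 0 ->
  (forall s t, 0 <= s -> s <= t -> t <= T -> t - s < d -> P s -> P t) ->
  forall t, 0 <= t <= T -> P t.
Proof.
move=> d0 P0 PS t /andP[t0 tT].
have d20 : 0 < d / 2 by rewrite divr_gt0.
have [n tn] : exists n : nat, t <= n%:R * (d / 2).
  exists (Num.bound (t / (d / 2))); rewrite -ler_pdivrMr//.
  by apply/ltW/archi_boundP; rewrite divr_ge0// ltW.
elim: n t t0 tT tn => [|n IH] t t0 tT tn.
  by rewrite (_ : t = 0)//; apply/le_anti; rewrite t0 andbT; move: tn; rewrite mul0r.
have [td|td] := leP t (d / 2).
  by apply: (PS 0) => //; lra.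
apply: (PS (t - d / 2)) => //; [lra|lra|lra|].
apply: IH; [lra|lra|]; move: tn; rewrite -natr1 mulrDl mul1r; lra.
Qed.

(** Summing the increments over a fine subdivision bounds [d] by an arbitrarily
    small multiple of an increment of [K].  This replaces differentiation almost
    everywhere: a function is identified with an integral by comparing their
    increments over short intervals. *)
Lemma small_increments T (d K : R -> R) : d 0 = 0 ->
  (forall e : R, 0 < e -> exists2 h : R, 0 < h & forall s t : R, 0 <= s -> s <= t -> t <= T ->
     t - s < h -> `|d t - d s| <= e * (K t - K s)) ->
  forall t, 0 <= t <= T -> d t = 0.
Proof.
move=> d0 dK t tT.
have H e : 0 < e -> `|d t| <= e * (K t - K 0).
  move=> e0; have [h h0 hP] := dK _ e0.
  apply: (step_induction (P := fun t => `|d t| <= e * (K t - K 0)) h0 _ _ tT);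
    first by rewrite d0 normr0 subrr mulr0.
  move=> s r s0 sr rT rsh IH.
  have := hP _ _ s0 sr rT rsh; have := ler_normD (d r - d s) (d s).
  rewrite subrK; move: IH; lra.
have C0 : 0 <= K t - K 0 by have := H 1 ltr01; rewrite mul1r; apply: le_trans.
apply/normr0_eq0/le_anti; rewrite normr_ge0 andbT.
rewrite leNgt; apply/negP => dt0.
have e0 : 0 < `|d t| / 2 / (K t - K 0 + 1) by rewrite !divr_gt0//; lra.
have := H _ e0; apply/negP; rewrite -ltNge.
rewrite mulrAC ltr_pdivrMr; last lra.
have := mulr_ge0 (normr_ge0 (d t)) C0; nra.
Qed.

Lemma le_norm_itg T f g s t c : 0 <= s -> t <= T -> L1 T f ->
  measurable_fun `[0, T] g ->
  (forall r, s <= r <= t -> `|g r| <= c) ->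
  `|\int[mu]_(x in `[s, t]) (g x * f x)| <= c * \int[mu]_(x in `[s, t]) `|f x|.
Proof.
move=> s0 tT fi mg gc.
have sub : `[s, t] `<=` `[0, T].
  move=> x /=; rewrite !in_itv /= => /andP[sx xt].
  by rewrite (le_trans s0 sx) (le_trans xt tT).
have fi' := L1_integrableS s0 tT fi.
have cfi : mu.-integrable `[s, t] (EFin \o (fun x => c * `|f x|)).
  exact: (integrableZl _ c (integrable_norm fi')).
have gfi : mu.-integrable `[s, t] (EFin \o (fun x => g x * f x)).
  apply: le_integrable cfi => //.
    apply/measurable_EFinP/measurable_funM; first exact: measurable_funS mg.
    exact: measurable_funS (L1_measurable fi).
  move=> x; rewrite /= in_itv /= => xst.
  by rewrite lee_fin normrM (le_trans _ (ler_norm _))// ler_wpM2r// gc.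
apply: (le_trans (le_normr_Rintegral _ gfi)) => //.
rewrite -RintegralZl//; last exact: integrable_norm.
apply: le_Rintegral => //; first exact: integrable_norm.
by move=> x; rewrite /= in_itv /= normrM => xst; rewrite ler_wpM2r// gc.
Qed.

(** Over a short interval, the increment of [F G] and the integral of
    [f G + F g] differ at most by the oscillations of [F] and [G] times the
    integral of [`|f| + `|g|]. *)
Lemma primitiveM T F G f g : primitive T F f -> primitive T G g ->
  primitive T (fun t => F t * G t) (fun t => f t * G t + F t * g t).
Proof.
move=> Ff Gg.
have fGi : L1 T (fun t => G t * f t) := L1M Gg Ff.1.
have Fgi : L1 T (fun t => F t * g t) := L1M Ff Gg.1.
have hi : L1 T (fun t => f t * G t + F t * g t).
  apply: L1D => //.
  by apply: eq_L1 fGi => t _; rewrite mulrC.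
split=> //; pose P t := \int[mu]_(s in `[0, t]) (f s * G s + F s * g s).
have Pp := primitive_int hi.
pose d t := F t * G t - F 0 * G 0 - P t.
move=> t tT; apply/eqP; rewrite -subr_eq0 opprD addrA; apply/eqP.
move: t tT; apply: (@small_increments _ d
  (fun t => \int[mu]_(s in `[0, t]) (`|f s| + `|g s|))).
  by rewrite /d /P itg0 subrr subr0.
move=> e e0.
have [h1 h10 h1P] := primitive_unif_cont Ff e0.
have [h2 h20 h2P] := primitive_unif_cont Gg e0.
exists (Num.min h1 h2); first by rewrite lt_min h10.
move=> s t s0 st tT; rewrite lt_min => /andP[th1 th2].
have sT : s <= T := le_trans st tT.
have fi := L1_integrableS s0 tT Ff.1; have gi := L1_integrableS s0 tT Gg.1.
have -> : d t - d s =
    \int[mu]_(r in `[s, t]) ((G t - G r) * f r) +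
    \int[mu]_(r in `[s, t]) ((F s - F r) * g r).
  have -> : d t - d s = G t * (F t - F s) + F s * (G t - G s) - (P t - P s).
    by rewrite /d; ring.
  rewrite (primitive_sub Ff s0 st tT) (primitive_sub Gg s0 st tT).
  rewrite (primitive_sub Pp s0 st tT) -!RintegralZl//.
  have i1 : mu.-integrable `[s, t] (EFin \o (fun x => G t * f x)).
    exact: (integrableZl _ (G t) fi).
  have i2 : mu.-integrable `[s, t] (EFin \o (fun x => F s * g x)).
    exact: (integrableZl _ (F s) gi).
  have i3 := L1_integrableS s0 tT fGi; have i4 := L1_integrableS s0 tT Fgi.
  under [in RHS]eq_Rintegral do rewrite mulrBl.
  under [X in _ = _ + X]eq_Rintegral do rewrite mulrBl.
  rewrite !RintegralB//.
  under [X in _ - X = _]eq_Rintegral do rewrite mulrC.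
  rewrite RintegralD//; ring.
apply: (le_trans (ler_normD _ _)).
have -> : \int[mu]_(s in `[0, t]) (`|f s| + `|g s|) -
    \int[mu]_(s in `[0, s]) (`|f s| + `|g s|) =
    \int[mu]_(s in `[s, t]) `|f s| + \int[mu]_(s in `[s, t]) `|g s|.
  rewrite (itg_split s0 st tT (L1D (L1_norm Ff.1) (L1_norm Gg.1))).
  by rewrite addrC addKr RintegralD//; exact: integrable_norm.
rewrite mulrDr lerD//.
- apply: (le_norm_itg s0 tT Ff.1).
    apply: measurable_funB => //; exact: primitive_measurable Gg.
  move=> r /andP[sr rt]; apply/ltW/h2P.
  + by rewrite (le_trans s0 sr) (le_trans rt tT).
  + by rewrite (le_trans s0 st) tT.
  + by rewrite ger0_norm ?subr_ge0// (le_lt_trans _ th2)// lerD2l lerN2.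
- apply: (le_norm_itg s0 tT Gg.1).
    apply: measurable_funB => //; exact: primitive_measurable Ff.
  move=> r /andP[sr rt]; apply/ltW/h1P.
  + by rewrite (le_trans s0 sr) (le_trans rt tT).
  + by rewrite s0.
  + by rewrite distrC ger0_norm ?subr_ge0// (le_lt_trans _ th1)// lerD2r.
Qed.

Lemma expR_sub1Dx_le (x : R) : x <= 2^-1 -> `|expR x - (1 + x)| <= 2 * x ^+ 2.
Proof.
move=> x2; have := expR_ge1Dx (- x); have := expR_ge1Dx x; have := expR_gt0 x.
rewrite expRN; set y := expR x => y0 y1 yV.
rewrite ger0_norm ?subr_ge0//.
have : (1 - x) * y <= 1 by rewrite -ler_pdivlMr// mul1r.
by nra.
Qed.

Lemma expR_sub1_le (x : R) : `|x| <= 2^-1 -> `|expR x - 1| <= 2 * `|x|.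
Proof.
move=> x2; have := expR_sub1Dx_le (le_trans (ler_norm x) x2).
have := ler_normD (expR x - (1 + x)) x.
rewrite (_ : _ + x = expR x - 1); last by ring.
rewrite -(real_normK (num_real x)); have := normr_ge0 x; nra.
Qed.

(** As for products, by comparing increments; [expR x - (1 + x)] is quadratic, so
    the oscillation of [F] over a short interval makes it negligible. *)
Lemma primitive_expR T F f : primitive T F f ->
  primitive T (fun t => expR (F t)) (fun t => expR (F t) * f t).
Proof.
move=> Ff; have [M FM] := primitive_bounded Ff.
have eb t : 0 <= t <= T -> expR (F t) <= expR M.
  by move=> tT; rewrite ler_expR (le_trans (ler_norm _))// FM.
have me : measurable_fun `[0, T] (fun t => expR (F t)).
  by apply: measurableT_comp => //; exact: primitive_measurable Ff.
have hi : L1 T (fun t => expR (F t) * f t).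
  apply: (L1_le _ _ (L1Z (expR M) (L1_norm Ff.1))).
    by apply: measurable_funM => //; exact: L1_measurable Ff.1.
  by move=> t tT; rewrite normrM ger0_norm ?expR_ge0// ler_wpM2r// eb.
split=> //; pose P t := \int[mu]_(s in `[0, t]) (expR (F s) * f s).
have Pp := primitive_int hi.
pose d t := expR (F t) - expR (F 0) - P t.
move=> t tT; apply/eqP; rewrite -subr_eq0 opprD addrA; apply/eqP.
move: t tT; apply: (@small_increments _ d
  (fun t => \int[mu]_(s in `[0, t]) `|f s|)).
  by rewrite /d /P itg0 subrr subr0.
move=> e e0.
pose e' := Num.min (2^-1) (e / (4 * expR M)).
have e'0 : 0 < e' by rewrite lt_min invr_gt0 ltr0n/= divr_gt0// mulr_gt0 ?expR_gt0.
have [h h0 hP] := primitive_unif_cont Ff e'0.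
exists h => // s t s0 st tT tsh.
have sT : s <= T := le_trans st tT.
have fi := L1_integrableS s0 tT Ff.1.
have e'e : expR M * (4 * e') <= e.
  have : e' <= e / (4 * expR M) by rewrite ge_min lexx orbT.
  by rewrite ler_pdivlMr ?mulr_gt0 ?expR_gt0//; nra.
have cl r : s <= r <= t -> `|F r - F s| <= e'.
  move=> /andP[sr rt]; rewrite distrC.
  apply/ltW/hP; rewrite ?s0 ?sT ?(le_trans s0 sr) ?(le_trans rt tT)//.
  by rewrite distrC ger0_norm ?subr_ge0// (le_lt_trans _ tsh)// lerD2r.
have ex r : expR (F r) = expR (F s) * expR (F r - F s).
  by rewrite -expRD addrC subrK.
have es : expR (F s) <= expR M by rewrite eb ?s0.
pose a := expR (F s) * (expR (F t - F s) - (1 + (F t - F s))).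
have -> : d t - d s = a -
    \int[mu]_(r in `[s, t]) ((expR (F r) - expR (F s)) * f r).
  under eq_Rintegral do rewrite mulrBl.
  have hi' := L1_integrableS s0 tT hi.
  have fi' : mu.-integrable `[s, t] (EFin \o (fun x => expR (F s) * f x)).
    exact: (integrableZl _ (expR (F s)) fi).
  rewrite (RintegralB _ hi' fi')//.
  rewrite RintegralZl// -(primitive_sub Ff s0 st tT) -(primitive_sub Pp s0 st tT).
  by rewrite /d /a mulrBr -ex /P; ring.
rewrite (itg_split s0 st tT (L1_norm Ff.1)) [X in e * X]addrC addKr.
set I := \int[mu]_(r in `[s, t]) `|f r|.
have I0 : 0 <= I by apply: Rintegral_ge0 => x _.
have FI : `|F t - F s| <= I := primitive_dist Ff s0 st tT.
have Fe : `|F t - F s| <= e' by apply: cl; rewrite st lexx.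
have e'2 : e' <= 2^-1 by rewrite ge_min lexx.
have aI : `|a| <= expR M * (2 * e') * I.
  rewrite /a normrM ger0_norm ?expR_ge0// -mulrA.
  apply: ler_pM; rewrite ?expR_ge0//.
  apply: (le_trans (expR_sub1Dx_le _)).
    exact: le_trans (ler_norm _) (le_trans Fe e'2).
  rewrite -(real_normK (num_real (F t - F s))); have := normr_ge0 (F t - F s); nra.
have bI : `|\int[mu]_(r in `[s, t]) ((expR (F r) - expR (F s)) * f r)|
    <= expR M * (2 * e') * I.
  apply: (le_norm_itg s0 tT Ff.1); first exact: measurable_funB.
  move=> r rst; rewrite ex -[X in _ - X]mulr1 -mulrBr normrM ger0_norm ?expR_ge0//.
  apply: ler_pM; rewrite ?expR_ge0//.
  apply: le_trans (expR_sub1_le _) _; first exact: le_trans (cl _ rst) e'2.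
  by rewrite ler_pM2l// cl.
have := ler_normB a (\int[mu]_(r in `[s, t]) ((expR (F r) - expR (F s)) * f r)).
nra.
Qed.

(** The integral [W] of [k w] satisfies [W' <= k W], so that [expR (- K) W] is
    nonincreasing, where [K] is the integral of [k]. *)
Lemma gronwall T (k w : R -> R) : L1 T k -> L1 T (fun t => k t * w t) ->
  (forall t, 0 <= t <= T -> 0 <= k t) ->
  (forall t, 0 <= t <= T -> w t <= \int[mu]_(s in `[0, t]) (k s * w s)) ->
  forall t, 0 <= t <= T -> w t <= 0.
Proof.
move=> ki kwi k0 wW t tT; have /andP[t0 tT'] := tT.
apply: (le_trans (wW _ tT)).
have Kp := primitive_expR (primitiveZ (-1) (primitive_int ki)).
have Wp := primitive_int kwi.
have := primitiveZ (-1) (primitiveM Kp Wp).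
move=> /primitive_le /(_ _ (lexx _) t0 tT').
rewrite !itg0 !mulr0 => H.
have /H : forall x, 0 <= x <= T -> 0 <= -1 *
   (expR (-1 * \int[mu]_(s in `[0, x]) k s) * (-1 * k x) *
     \int[mu]_(s in `[0, x]) (k s * w s) +
    expR (-1 * \int[mu]_(s in `[0, x]) k s) * (k x * w x)).
  move=> x xT; have := wW _ xT; have := k0 _ xT.
  have := expR_gt0 (-1 * \int[mu]_(s in `[0, x]) k s).
  set e := expR _; set W := Rintegral _ _ _ => e0 k0x xW.
  have : 0 <= e * (k x * (W - w x)) by rewrite !mulr_ge0// ?subr_ge0// ltW.
  by lra.
by rewrite mulN1r oppr_ge0 pmulr_rle0// expR_gt0.
Qed.

End calculus.

(** * Quadratic forms and Kronecker products *)

Section forms.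
Context {R : realType}.

Definition dot n (v w : 'cV[R]_n) : R := \sum_i v i 0 * w i 0.
Definition bform n (M : 'M[R]_n) (v w : 'cV[R]_n) : R := dot v (M *m w).
Definition qform n (M : 'M[R]_n) (v : 'cV[R]_n) : R := bform M v v.
(** Symmetry is kept apart: matrices are compared through their quadratic forms. *)
Definition psd n (M : 'M[R]_n) := forall v, 0 <= qform M v.

Lemma dotE n (v w : 'cV[R]_n) : dot v w = (v^T *m w) 0 0.
Proof. by rewrite mxE; apply: eq_bigr => i _; rewrite mxE. Qed.

Lemma dotC n (v w : 'cV[R]_n) : dot v w = dot w v.
Proof. by apply: eq_bigr => i _; rewrite mulrC. Qed.

Lemma dotDl n (u v w : 'cV[R]_n) : dot (u + v) w = dot u w + dot v w.
Proof. by rewrite -big_split; apply: eq_bigr => i _; rewrite mxE mulrDl. Qed.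

Lemma dotDr n (u v w : 'cV[R]_n) : dot w (u + v) = dot w u + dot w v.
Proof. by rewrite dotC dotDl !(dotC w). Qed.

Lemma dotZl n a (v w : 'cV[R]_n) : dot (a *: v) w = a * dot v w.
Proof. by rewrite mulr_sumr; apply: eq_bigr => i _; rewrite mxE mulrA. Qed.

Lemma dotZr n a (v w : 'cV[R]_n) : dot v (a *: w) = a * dot v w.
Proof. by rewrite dotC dotZl dotC. Qed.

Lemma dot0l n (w : 'cV[R]_n) : dot 0 w = 0.
Proof. by rewrite /dot big1// => i _; rewrite mxE mul0r. Qed.

Lemma dot0r n (w : 'cV[R]_n) : dot w 0 = 0.
Proof. by rewrite dotC dot0l. Qed.

Lemma dot_suml n (I : Type) (r : seq I) (P : pred I) (F : I -> 'cV[R]_n) w :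
  dot (\sum_(i <- r | P i) F i) w = \sum_(i <- r | P i) dot (F i) w.
Proof.
elim/big_rec2: _ => [|i x y _ <-]; [exact: dot0l|by rewrite dotDl].
Qed.

Lemma dot_sumr n (I : Type) (r : seq I) (P : pred I) (F : I -> 'cV[R]_n) w :
  dot w (\sum_(i <- r | P i) F i) = \sum_(i <- r | P i) dot w (F i).
Proof. by rewrite dotC dot_suml; apply: eq_bigr => i _; rewrite dotC. Qed.

Lemma dot_mulmx p q (A : 'M[R]_(p, q)) v w : dot v (A *m w) = dot (A^T *m v) w.
Proof. by rewrite !dotE trmx_mul trmxK mulmxA. Qed.

Lemma dot_delta n (v : 'cV[R]_n) i : dot (delta_mx i 0) v = v i 0.
Proof.
rewrite /dot (bigD1 i)//= mxE !eqxx mul1r big1 ?addr0// => j ji.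
by rewrite mxE (negbTE ji) mul0r.
Qed.

Lemma dot_ge0 n (v : 'cV[R]_n) : 0 <= dot v v.
Proof. by apply: sumr_ge0 => i _; rewrite -expr2 sqr_ge0. Qed.

Lemma bformE n (M : 'M[R]_n) v w :
  bform M v w = \sum_i \sum_j v i 0 * M i j * w j 0.
Proof.
apply: eq_bigr => i _; rewrite mxE mulr_sumr.
by apply: eq_bigr => j _; rewrite mulrA.
Qed.

Lemma bformDm n (M M' : 'M[R]_n) v w : bform (M + M') v w = bform M v w + bform M' v w.
Proof. by rewrite /bform mulmxDl dotDr. Qed.

Lemma bformZm n a (M : 'M[R]_n) v w : bform (a *: M) v w = a * bform M v w.
Proof. by rewrite /bform -scalemxAl dotZr. Qed.

Lemma bformDl n (M : 'M[R]_n) u v w : bform M (u + v) w = bform M u w + bform M v w.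
Proof. exact: dotDl. Qed.

Lemma bformDr n (M : 'M[R]_n) u v w : bform M w (u + v) = bform M w u + bform M w v.
Proof. by rewrite /bform mulmxDr dotDr. Qed.

Lemma bformZl n (M : 'M[R]_n) a v w : bform M (a *: v) w = a * bform M v w.
Proof. exact: dotZl. Qed.

Lemma bformZr n (M : 'M[R]_n) a v w : bform M v (a *: w) = a * bform M v w.
Proof. by rewrite /bform -scalemxAr dotZr. Qed.

Lemma bform_sumr n (M : 'M[R]_n) (I : Type) (r : seq I) (P : pred I)
    (F : I -> 'cV[R]_n) w :
  bform M w (\sum_(i <- r | P i) F i) = \sum_(i <- r | P i) bform M w (F i).
Proof. by rewrite /bform mulmx_sumr dot_sumr. Qed.

Lemma bform_suml n (M : 'M[R]_n) (I : Type) (r : seq I) (P : pred I)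
    (F : I -> 'cV[R]_n) w :
  bform M (\sum_(i <- r | P i) F i) w = \sum_(i <- r | P i) bform M (F i) w.
Proof. exact: dot_suml. Qed.

Lemma bform_mulmx p q (B : 'M[R]_(p, q)) (M : 'M[R]_q) (C : 'M[R]_(q, p)) v w :
  bform (B *m M *m C) v w = bform M (B^T *m v) (C *m w).
Proof. by rewrite /bform -!mulmxA dot_mulmx. Qed.

Lemma qform0m n (v : 'cV[R]_n) : qform 0 v = 0.
Proof. by rewrite /qform /bform mul0mx dot0r. Qed.

Lemma qformDm n (M M' : 'M[R]_n) v : qform (M + M') v = qform M v + qform M' v.
Proof. exact: bformDm. Qed.

Lemma qformBm n (M M' : 'M[R]_n) v : qform (M - M') v = qform M v - qform M' v.
Proof. by rewrite /qform /bform mulmxBl -scaleN1r dotDr dotZr mulN1r. Qed.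

Lemma qformZm n a (M : 'M[R]_n) v : qform (a *: M) v = a * qform M v.
Proof. exact: bformZm. Qed.

Lemma qform_sum n (I : Type) (r : seq I) (P : pred I) (F : I -> 'M[R]_n) v :
  qform (\sum_(i <- r | P i) F i) v = \sum_(i <- r | P i) qform (F i) v.
Proof.
elim/big_rec2: _ => [|i x y _ <-]; [exact: qform0m|by rewrite qformDm].
Qed.

Lemma qform_outer n p (B : 'M[R]_(n, p)) v :
  qform (B *m B^T) v = dot (B^T *m v) (B^T *m v).
Proof. by rewrite /qform /bform -mulmxA dot_mulmx. Qed.

Lemma qform_col n (y v : 'cV[R]_n) : qform (y *m y^T) v = dot v y ^+ 2.
Proof.
rewrite qform_outer {1}/dot big_ord1 -expr2; congr (_ ^+ 2).
by rewrite dotC dotE.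
Qed.

Lemma bform_outer n (x y v w : 'cV[R]_n) :
  bform (x *m y^T) v w = dot v x * dot w y.
Proof. by rewrite /bform -mulmxA dot_mulmx /dot big_ord1 -!/(dot _ _) -!dotE (dotC x) (dotC y). Qed.

Lemma qform_conj n p (B : 'M[R]_(n, p)) M v :
  qform (B *m M *m B^T) v = qform M (B^T *m v).
Proof. exact: bform_mulmx. Qed.

Lemma qform_le n (M : 'M[R]_n) (c : R) v : (forall i j, `|M i j| <= c) ->
  `|qform M v| <= c * n%:R * dot v v.
Proof.
move=> Mc; rewrite /qform bformE.
apply: (@le_trans _ _ (\sum_i \sum_j c * ((v i 0 * v i 0 + v j 0 * v j 0) / 2))).
  apply: (le_trans (ler_norm_sum _ _ _)); apply: ler_sum => i _.
  apply: (le_trans (ler_norm_sum _ _ _)); apply: ler_sum => j _.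
  rewrite !normrM (mulrC `|v i 0|) -mulrA; apply: ler_pM => //.
  have := sqr_ge0 (`|v i 0| - `|v j 0|).
  rewrite sqrrB !real_normK ?num_real// !expr2.
  set x := v i 0 * _; set y := v j 0 * _; set z := `|_| * _; lra.
have -> : \sum_i \sum_j c * ((v i 0 * v i 0 + v j 0 * v j 0) / 2) =
    \sum_(i < n) \sum_(j < n) c / 2 * (v i 0 * v i 0) +
    \sum_(i < n) \sum_(j < n) c / 2 * (v j 0 * v j 0).
  rewrite -big_split; apply: eq_bigr => i _; rewrite -big_split.
  by apply: eq_bigr => j _ /=; field.
rewrite [X in X + _]exchange_big /= !sumr_const !card_ord -mulr_sumr -/(dot v v).
by rewrite -mulr_natr le_eqVlt; apply/orP; left; apply/eqP; field.
Qed.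

Definition sumnorm p q (X : 'M[R]_(p, q)) : R := \sum_i \sum_j `|X i j|.

Lemma sumnorm_ge0 p q (X : 'M[R]_(p, q)) : 0 <= sumnorm X.
Proof. by do 2 apply: sumr_ge0 => ? _. Qed.

Lemma le_sumnorm p q (X : 'M[R]_(p, q)) i j : `|X i j| <= sumnorm X.
Proof.
rewrite /sumnorm (bigD1 i)//= (bigD1 j)//= -addrA lerDl addr_ge0//.
  exact: sumr_ge0.
by apply: sumr_ge0 => ? _; exact: sumr_ge0.
Qed.

Lemma qform_bound n (M : 'M[R]_n) :
  exists2 c : R, 0 <= c & forall v, `|qform M v| <= c * dot v v.
Proof.
exists (sumnorm M * n%:R); first by rewrite mulr_ge0 ?sumnorm_ge0.
by move=> v; apply: qform_le => i j; exact: le_sumnorm.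
Qed.

Lemma dot_mulmx_bound p q (B : 'M[R]_(p, q)) :
  exists2 c : R, 0 <= c & forall v, dot (B *m v) (B *m v) <= c * dot v v.
Proof.
have [c c0 Bc] := qform_bound (B^T *m B^T^T); exists c => // v.
by rewrite -{1 2}(trmxK B) -qform_outer (le_trans (ler_norm _)).
Qed.

Definition blk m n (w : 'cV[R]_(m * n)) (k : 'I_m) : 'cV[R]_n :=
  \col_j w (mxtens_index (k, j)) 0.

Lemma sum_mxtens_index m n (F : 'I_(m * n) -> R) :
  \sum_i F i = \sum_k \sum_j F (mxtens_index (k, j)).
Proof.
rewrite pair_bigA; rewrite (reindex (@mxtens_index m n))/=; last first.
  by exists (@mxtens_unindex m n) => ? _; [exact: mxtens_indexK|exact: mxtens_unindexK].
by apply: eq_bigr => -[k j].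
Qed.

Lemma kron_cvE m n (a : 'cV[R]_m) (b : 'cV[R]_n) k j :
  kron_cv a b (mxtens_index (k, j)) 0 = a k 0 * b j 0.
Proof.
rewrite /kron_cv mxE mxtens_indexK /=.
by congr (a _ _ * b _ _); exact/val_inj.
Qed.

Lemma kron_cvDl p q (a b : 'cV[R]_p) (c : 'cV[R]_q) :
  kron_cv (a + b) c = kron_cv a c + kron_cv b c.
Proof. by apply/matrixP => i j; rewrite /kron_cv !mxE mulrDl. Qed.

Lemma kron_cvDr p q (a : 'cV[R]_p) (b c : 'cV[R]_q) :
  kron_cv a (b + c) = kron_cv a b + kron_cv a c.
Proof. by apply/matrixP => i j; rewrite /kron_cv !mxE mulrDr. Qed.

Lemma kron_cvBl p q (a b : 'cV[R]_p) (c : 'cV[R]_q) :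
  kron_cv (a - b) c = kron_cv a c - kron_cv b c.
Proof. by apply/matrixP => i j; rewrite /kron_cv !mxE mulrBl. Qed.

Lemma kron_cvBr p q (a : 'cV[R]_p) (b c : 'cV[R]_q) :
  kron_cv a (b - c) = kron_cv a b - kron_cv a c.
Proof. by apply/matrixP => i j; rewrite /kron_cv !mxE mulrBr. Qed.

Lemma kron_cv0l p q (c : 'cV[R]_q) : kron_cv (0 : 'cV[R]_p) c = 0.
Proof. by apply/matrixP => i j; rewrite /kron_cv !mxE mul0r. Qed.

Lemma kron_cv0r p q (c : 'cV[R]_p) : kron_cv c (0 : 'cV[R]_q) = 0.
Proof. by apply/matrixP => i j; rewrite /kron_cv !mxE mulr0. Qed.

Lemma kron_cv_suml p q (I : Type) (r : seq I) (P : pred I) (F : I -> 'cV[R]_p)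
    (c : 'cV[R]_q) :
  kron_cv (\sum_(i <- r | P i) F i) c = \sum_(i <- r | P i) kron_cv (F i) c.
Proof.
by elim/big_rec2: _ => [|i x y _ <-]; rewrite ?kron_cv0l ?kron_cvDl.
Qed.

Lemma kron_cv_sumr p q (I : Type) (r : seq I) (P : pred I) (F : I -> 'cV[R]_q)
    (c : 'cV[R]_p) :
  kron_cv c (\sum_(i <- r | P i) F i) = \sum_(i <- r | P i) kron_cv c (F i).
Proof.
by elim/big_rec2: _ => [|i x y _ <-]; rewrite ?kron_cv0r ?kron_cvDr.
Qed.

Lemma dot_kron m n (w : 'cV[R]_(m * n)) a b :
  dot w (kron_cv a b) = \sum_k a k 0 * dot (blk w k) b.
Proof.
rewrite /dot sum_mxtens_index; apply: eq_bigr => k _.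
by rewrite mulr_sumr; apply: eq_bigr => j _; rewrite kron_cvE mxE mulrCA.
Qed.

Lemma qform_tens m n (X : 'M[R]_m) (Y : 'M[R]_n) w :
  qform (X *t Y) w = \sum_k \sum_l X k l * bform Y (blk w k) (blk w l).
Proof.
rewrite /qform bformE sum_mxtens_index; apply: eq_bigr => k _.
under eq_bigr do rewrite sum_mxtens_index.
rewrite exchange_big; apply: eq_bigr => l _.
rewrite bformE mulr_sumr; apply: eq_bigr => i _.
rewrite mulr_sumr; apply: eq_bigr => j _.
by rewrite tensmxE !mxE; ring.
Qed.

Lemma qform_tens1 m n (Y : 'M[R]_n) w :
  qform ((1%:M : 'M[R]_m) *t Y) w = \sum_k qform Y (blk w k).
Proof.
rewrite qform_tens; apply: eq_bigr => k _.
rewrite (bigD1 k)//= mxE eqxx mul1r big1 ?addr0// => l /negbTE lk.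
by rewrite mxE eq_sym lk mul0r.
Qed.

Lemma sum_dot_blk m n (w : 'cV[R]_(m * n)) :
  \sum_k dot (blk w k) (blk w k) = dot w w.
Proof.
rewrite [RHS]/dot sum_mxtens_index; apply: eq_bigr => k _.
by apply: eq_bigr => j _; rewrite !mxE.
Qed.

(** Symmetric elimination: subtracting the rank-one matrix that clears a row and
    a column leaves the form nonnegative, because it amounts to minimising the
    form along a coordinate direction. *)
Lemma psd_outer_decomp n (P : 'M[R]_n) : P^T = P -> psd P ->
  exists s : seq 'cV[R]_n, P = \sum_(l <- s) l *m l^T.
Proof.
suff H k (Q : 'M[R]_n) : (forall i j : 'I_n, (k <= i)%N -> Q i j = 0) ->
    Q^T = Q -> psd Q -> exists s : seq 'cV[R]_n, Q = \sum_(l <- s) l *m l^T.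
  by apply: (H n) => i j; rewrite leqNgt ltn_ord.
elim: k Q => [|k IH] Q Q0 QT Qp.
  by exists [::]; rewrite big_nil; apply/matrixP => i j; rewrite Q0// mxE.
have [kn|nk] := ltnP k n; last first.
  by apply: IH => // i j ki; have := ltn_ord i; rewrite ltnNge (leq_trans nk ki).
pose i0 := Ordinal kn; pose d := Q i0 i0.
have Qsym i j : Q i j = Q j i by rewrite -{1}QT mxE.
have bsym v w : bform Q v w = bform Q w v.
  by rewrite /bform dotC dot_mulmx QT dotC dotC.
have qe v s : qform Q (v + s *: delta_mx i0 0) =
    qform Q v + 2 * s * (Q *m v) i0 0 + s ^+ 2 * d.
  rewrite /qform bformDl !bformDr !bformZl !bformZr (bsym v).
  have -> : bform Q (delta_mx i0 0) v = (Q *m v) i0 0 by exact: dot_delta.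
  have -> : bform Q (delta_mx i0 0) (delta_mx i0 0) = d.
    by rewrite /bform dot_delta -colE mxE.
  ring.
have split_k (i : 'I_n) : (k <= i)%N -> i = i0 \/ (k.+1 <= i)%N.
  by rewrite leq_eqVlt => /orP[/eqP ki|]; [left; exact/val_inj|right].
have [d0|dN0] := eqVneq d 0.
  apply: IH => // i j /split_k[->{i}|]; last exact: Q0.
  have H s : 0 <= Q j j + 2 * s * Q i0 j.
    have := Qp (delta_mx j 0 + s *: delta_mx i0 0).
    by rewrite qe d0 mulr0 addr0 -colE mxE /qform /bform dot_delta -colE mxE.
  apply/eqP; apply: contraT => Qn0.
  have := H (- (Q j j + 1) / (2 * Q i0 j)).
  rewrite (_ : _ + _ = -1); first by rewrite lerNr oppr0 ler10.
  by field; rewrite Qn0.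
have d_gt0 : 0 < d.
  rewrite lt0r dN0 /=; have := Qp (delta_mx i0 0).
  by rewrite /qform /bform dot_delta -colE mxE.
pose l : 'cV[R]_n := (Num.sqrt d)^-1 *: col i0 Q.
have ll i j : (l *m l^T) i j = Q i i0 * Q j i0 / d.
  rewrite mxE big_ord1 !mxE -[in RHS](sqr_sqrtr (ltW d_gt0)) expr2.
  by field; rewrite sqrtr_eq0 -ltNge.
have [|||s Es] := IH (Q - l *m l^T).
- move=> i j /split_k[->{i}|ki]; rewrite mxE [X in _ + X]mxE ll.
    by rewrite (Qsym j) -/d; field.
  by rewrite (Q0 i j)// (Q0 i i0)// !mul0r subrr.
- by rewrite linearB /= trmx_mul trmxK QT.
- move=> v; pose s := - ((Q *m v) i0 0 / d).
  have : 0 <= qform Q (v + s *: delta_mx i0 0) := Qp _.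
  rewrite qe qformDm -[- (l *m _)]scaleN1r qformZm qform_col.
  have -> : dot v l ^+ 2 = (Q *m v) i0 0 ^+ 2 / d.
    have -> : dot v l = (Num.sqrt d)^-1 * (Q *m v) i0 0.
      rewrite dotZr; congr (_ * _); rewrite mxE.
      by apply: eq_bigr => j _; rewrite mxE mulrC Qsym.
    rewrite -[in RHS](sqr_sqrtr (ltW d_gt0)).
    by field; rewrite sqrtr_eq0 -ltNge.
  rewrite /s; suff -> : forall x y : R, x + 2 * - (y / d) * y + (- (y / d)) ^+ 2 * d =
    x + -1 * (y ^+ 2 / d) by [].
  by move=> x y; field.
by exists (l :: s); rewrite big_cons -Es addrC subrK.
Qed.

Lemma qform_tens_outer m n (s : seq 'cV[R]_m) (Q : 'M[R]_n) w :
  qform ((\sum_(l <- s) l *m l^T) *t Q) w =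
  \sum_(l <- s) qform Q (\sum_k l k 0 *: blk w k).
Proof.
rewrite qform_tens.
under eq_bigr do under eq_bigr do rewrite summxE mulr_suml.
under eq_bigr do rewrite exchange_big /=.
rewrite exchange_big /=; apply: eq_bigr => l _.
rewrite /qform bform_suml; apply: eq_bigr => i _.
rewrite bform_sumr; apply: eq_bigr => j _.
by rewrite mxE big_ord1 mxE bformZl bformZr mulrA.
Qed.

Lemma psd_tens m n (P : 'M[R]_m) (Q : 'M[R]_n) :
  P^T = P -> psd P -> psd Q -> psd (P *t Q).
Proof.
move=> PT Pp Qp w; have [s ->] := psd_outer_decomp PT Pp.
by rewrite qform_tens_outer; apply: sumr_ge0 => l _; exact: Qp.
Qed.

(** Read [w] as a matrix [W], so that [dot w (x *t y)] is [x^T W y], and write [P]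
    as a sum of [l l^T].  The bound on [x], with [y] frozen, leaves the squares of
    the [l^T W y]; to each of them the bound on [y] applies. *)
Lemma kron_dominated m n (P : 'M[R]_m) (Q : 'M[R]_n) x y (c d : R) :
  P^T = P -> psd P -> 0 <= c ->
  (forall v, dot v x ^+ 2 <= c * qform P v) ->
  (forall v, dot v y ^+ 2 <= d * qform Q v) ->
  forall w, dot w (kron_cv x y) ^+ 2 <= c * d * qform (P *t Q) w.
Proof.
move=> PT Pp c0 xP yQ w; have [s Ps] := psd_outer_decomp PT Pp.
pose z : 'cV[R]_m := \col_k dot (blk w k) y.
have -> : dot w (kron_cv x y) = dot z x.
  by rewrite dot_kron; apply: eq_bigr => k _; rewrite mxE mulrC.
apply: (le_trans (xP z)); rewrite -mulrA ler_wpM2l//.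
rewrite Ps qform_tens_outer qform_sum mulr_sumr; apply: ler_sum => l _.
rewrite qform_col; apply: le_trans (yQ _).
rewrite dot_suml dotC /dot; rewrite le_eqVlt; apply/orP; left; apply/eqP; congr (_ ^+ 2).
by apply: eq_bigr => k _; rewrite mxE -/(dot _ _) dotZl.
Qed.

Lemma amgm2 (s x y : R) : 0 <= x -> 0 <= y -> s ^+ 2 <= x * y -> 2 * s <= x + y.
Proof.
move=> x0 y0 sxy; have [s0|s0] := leP 0 s; last by lra.
rewrite -(ler_pXn2r (n := 2))// ?nnegrE ?addr_ge0 ?mulr_ge0//.
have := sqr_ge0 (x - y); lra.
Qed.

(** [amgm2] absorbs the cross terms. *)
Lemma sqr_sum_le (I : Type) (r : seq I) (P : pred I) (a al be : I -> R) :
  (forall i, P i -> 0 <= al i) -> (forall i, P i -> 0 <= be i) ->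
  (forall i, P i -> a i ^+ 2 <= al i * be i) ->
  (\sum_(i <- r | P i) a i) ^+ 2 <=
  (\sum_(i <- r | P i) al i) * (\sum_(i <- r | P i) be i).
Proof.
move=> al0 be0 ab; elim: r => [|i r IH]; first by rewrite !big_nil mul0r expr0n.
rewrite !big_cons; case: ifP => // Pi.
have := ab i Pi; have := al0 i Pi; have := be0 i Pi.
have : 0 <= \sum_(j <- r | P j) al j by exact: sumr_ge0.
have : 0 <= \sum_(j <- r | P j) be j by exact: sumr_ge0.
move: (\sum_(i <- r | P i) al i) (\sum_(i <- r | P i) be i) (\sum_(i <- r | P i) a i) IH.
move: (a i) (al i) (be i) => x p q X Y S SXY Y0 X0 q0 p0 xpq.
suff : 2 * (x * S) <= p * Y + X * q by lra.
apply: amgm2; rewrite ?mulr_ge0// exprMn [leRHS](_ : _ = (p * q) * (X * Y)).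
  by rewrite ler_pM ?sqr_ge0.
by ring.
Qed.

Lemma dot_sqr_le n (v w : 'cV[R]_n) : dot v w ^+ 2 <= dot v v * dot w w.
Proof.
apply: sqr_sum_le => i _; rewrite -?expr2 ?sqr_ge0//.
by rewrite exprMn.
Qed.

Lemma qform_gramian_op n m (A : 'M[R]_n) (N : 'M[R]_(n, m * n)) X v :
  qform (gramian_op A N X) v = bform X (A^T *m v) v + bform X v (A^T *m v) +
    \sum_k qform X (blk (N^T *m v) k).
Proof.
rewrite /gramian_op !qformDm qform_conj qform_tens1; congr (_ + _ + _).
  by rewrite /qform /bform -mulmxA dot_mulmx.
by rewrite /qform /bform -mulmxA.
Qed.

End forms.

(** * The comparison principle *)

Section positivity.
Context {R : realType}.
Local Notation mu := (@lebesgue_measure R).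
Implicit Types T t e : R.

Definition mx_primitive p q T (D D' : R -> 'M[R]_(p, q)) :=
  forall i j, primitive T (fun t => D t i j) (fun t => D' t i j).

Lemma primitive_bform n T (D D' : R -> 'M[R]_n) v w : mx_primitive T D D' ->
  primitive T (fun t => bform (D t) v w) (fun t => bform (D' t) v w).
Proof.
move=> DD'.
apply: (@eq_primitive _ T (fun t => \sum_i \sum_j (v i 0 * w j 0) * D t i j) _
  (fun t => \sum_i \sum_j (v i 0 * w j 0) * D' t i j)).
- move=> t _; rewrite bformE.
  by apply: eq_bigr => i _; apply: eq_bigr => j _; rewrite mulrAC.
- move=> t _; rewrite bformE.
  by apply: eq_bigr => i _; apply: eq_bigr => j _; rewrite mulrAC.
- by apply: primitive_sum => i _; apply: primitive_sum => j _; exact: primitiveZ.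
Qed.

Lemma primitive_qform n T (D D' : R -> 'M[R]_n) v : mx_primitive T D D' ->
  primitive T (fun t => qform (D t) v) (fun t => qform (D' t) v).
Proof. exact: primitive_bform. Qed.

(** Gives a modulus of continuity, and a bound, common to all the entries. *)
Lemma mx_primitive_majorant p q T (D D' : R -> 'M[R]_(p, q)) : mx_primitive T D D' ->
  exists K k : R -> R, primitive T K k /\
  forall s t : R, 0 <= s -> s <= t -> t <= T -> forall i j,
    `|D t i j - D s i j| <= K t - K s.
Proof.
move=> DD'; pose k t := \sum_i \sum_j `|D' t i j|.
have ki : L1 T k.
  by apply: L1_sum => i _; apply: L1_sum => j _; apply: L1_norm; exact: (DD' i j).1.
exists (fun t => \int[mu]_(s in `[0, t]) k s), k.
have Kk := primitive_int ki; split=> // s t s0 st tT i j.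
rewrite (primitive_sub Kk s0 st tT).
apply: (le_trans (primitive_dist (DD' i j) s0 st tT)).
apply: le_Rintegral => //.
- exact: L1_integrableS s0 tT (L1_norm (DD' i j).1).
- exact: L1_integrableS s0 tT ki.
- move=> x _; rewrite /k (bigD1 i)//= (bigD1 j)//= -addrA lerDl addr_ge0//.
    exact: sumr_ge0.
  by apply: sumr_ge0 => ? _; exact: sumr_ge0.
Qed.

Lemma mx_primitive_bounded p q T (D D' : R -> 'M[R]_(p, q)) : mx_primitive T D D' ->
  exists2 c : R, 0 <= c & forall t, 0 <= t <= T -> forall i j, `|D t i j| <= c.
Proof.
move=> DD'; have [K [k [Kk KD]]] := mx_primitive_majorant DD'.
have [c Kc] := primitive_bounded Kk.
exists (sumnorm (D 0) + `|c| + `|K 0|); first by rewrite !addr_ge0 ?sumnorm_ge0.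
move=> t tT i j; have /andP[t0 tT'] := tT.
have := KD 0 t (lexx _) t0 tT' i j; have := le_sumnorm (D 0) i j; have := Kc _ tT.
have := ler_normD (D t i j - D 0 i j) (D 0 i j); rewrite subrK.
have := ler_norm c; have := ler_norm (- K 0); rewrite normrN; have := ler_norm (K t).
lra.
Qed.

Lemma gramian_op_bound n m (A : 'M[R]_n) (N : 'M[R]_(n, m * n)) :
  exists2 c : R, 0 <= c & forall (X : 'M[R]_n) (w : R) v,
    (forall i j, `|X i j| <= w) ->
    `|qform (gramian_op A N X) v| <= c * w * dot v v.
Proof.
have [cA cA0 cAP] := dot_mulmx_bound A^T; have [cN cN0 cNP] := dot_mulmx_bound N^T.
exists (n%:R * (3 * cA + 3 + cN)).
  by rewrite mulr_ge0// !addr_ge0// mulr_ge0.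
move=> X w v Xw; rewrite qform_gramian_op; set a := A^T *m v.
have w0 : 0 <= w * n%:R.
  case: n A N v X Xw a {cAP cNP} => [|n] ? ? ? ? Xw _; first by rewrite mulr0.
  by rewrite mulr_ge0// (le_trans _ (Xw 0 0)).
have H u : `|qform X u| <= w * n%:R * dot u u := qform_le u Xw.
have -> : bform X a v + bform X v a = qform X (a + v) - qform X a - qform X v.
  by rewrite /qform !bformDl !bformDr; ring.
have av : dot (a + v) (a + v) <= 2 * dot a a + 2 * dot v v.
  have := dot_ge0 (a + (-1) *: v).
  rewrite !dotDl !dotDr !dotZl !dotZr (dotC v a); lra.
have aa := cAP v; rewrite -/a in aa.
have h1 := H (a + v); have h2 := H a; have h3 := H v.
have h4 : `|\sum_k qform X (blk (N^T *m v) k)| <= w * n%:R * (cN * dot v v).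
  apply: (le_trans (ler_norm_sum _ _ _)).
  apply: (@le_trans _ _ (w * n%:R * dot (N^T *m v) (N^T *m v))).
    rewrite -sum_dot_blk mulr_sumr; apply: ler_sum => k _; exact: H.
  by rewrite ler_wpM2l.
move: h1 h2 h3 h4; rewrite !ler_norml.
have : 0 <= w * n%:R * (2 * dot a a + 2 * dot v v - dot (a + v) (a + v)).
  by rewrite mulr_ge0// subr_ge0.
have : 0 <= w * n%:R * (cA * dot v v - dot a a) by rewrite mulr_ge0// subr_ge0.
have := mulr_ge0 w0 (dot_ge0 v).
lra.
Qed.

Lemma qform_gramian_opD n m (A : 'M[R]_n) (N : 'M[R]_(n, m * n)) X Y v :
  qform (gramian_op A N (X + Y)) v =
  qform (gramian_op A N X) v + qform (gramian_op A N Y) v.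
Proof.
rewrite !qform_gramian_op !bformDm (eq_bigr _ (fun k _ => qformDm X Y _)).
by rewrite big_split /=; ring.
Qed.

(** One time step [h] for [D' = A D + D A^T + sum_k N_k D N_k^T + k D], from [X]
    to [Y], with [a] the increment of the integral of [k].  The part with the
    [N_k] preserves positivity; the part with [A] is, up to second order in [h],
    the congruence by [1 + h A].  Hence a lower bound [- z |v|^2] of the form
    deteriorates only by a factor close to [1], as long as the errors, of relative
    size [e], do not exceed [z]. *)
Lemma psd_flow_step n m (A : 'M[R]_n) (N : 'M[R]_(n, m * n)) (X Y : 'M[R]_n) u
    (cA cN cL M h a z e w : R) :
  0 <= cA -> 0 <= cN ->
  (forall v, dot (A^T *m v) (A^T *m v) <= cA * dot v v) ->
  (forall v, dot (N^T *m v) (N^T *m v) <= cN * dot v v) ->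
  (forall i j, `|X i j| <= M) -> 0 <= h -> h <= 1 -> 0 <= a ->
  0 < e -> e <= z -> cL * w <= e / 2 -> n%:R * w <= e / 2 ->
  h * (n%:R * M * cA) <= e / 2 -> 0 <= n%:R * M ->
  (forall v, - z * dot v v <= qform X v) ->
  h * (qform (gramian_op A N X) u - cL * w * dot u u) +
    a * (qform X u - w * n%:R * dot u u) <= qform Y u - qform X u ->
  - (z * (1 + 2 * ((1 + 2 * cA + cN) * h + a))) * dot u u <= qform Y u.
Proof.
move=> cA0 cN0 cAP cNP XM h0 h1 a0 e0 ez lw nw hM nM IH incr.
have z0 : 0 < z := lt_le_trans e0 ez.
set v1 := A^T *m u; have aa : dot v1 v1 <= cA * dot u u := cAP u.
have qA : h * (bform X v1 u + bform X u v1) =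
    qform X (u + h *: v1) - qform X u - h ^+ 2 * qform X v1.
  by rewrite /qform !bformDl !bformDr !bformZl !bformZr; ring.
have dh : dot (u + h *: v1) (u + h *: v1) <= dot u u * (1 + h * (1 + 2 * cA)).
  have := dot_ge0 (u + (-1) *: v1).
  rewrite !dotDl !dotDr !dotZl !dotZr (dotC v1 u) => uv.
  have p1 : 0 <= h * (dot u u + dot v1 v1 - 2 * dot u v1).
    by apply: mulr_ge0 => //; lra.
  have p2 : 0 <= h * (1 - h) * dot v1 v1.
    by apply: mulr_ge0 (dot_ge0 _); apply: mulr_ge0 => //; lra.
  have p3 : 0 <= h * (cA * dot u u - dot v1 v1).
    by apply: mulr_ge0 => //; rewrite subr_ge0.
  lra.
have q1 : - z * (dot u u * (1 + h * (1 + 2 * cA))) <= qform X (u + h *: v1).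
  by apply: le_trans (IH _); rewrite !mulNr lerN2 ler_pM2l.
have q2 : qform X v1 <= n%:R * M * cA * dot u u.
  apply: (le_trans (ler_norm _)); apply: (le_trans (qform_le v1 XM)).
  rewrite (_ : n%:R * M * cA * dot u u = M * n%:R * (cA * dot u u)); last by ring.
  by apply: ler_wpM2l => //; rewrite mulrC.
have q3 : - (z * (cN * dot u u)) <= \sum_k qform X (blk (N^T *m u) k).
  apply: (@le_trans _ _ (- z * dot (N^T *m u) (N^T *m u))).
    by rewrite mulNr lerN2 ler_pM2l// cNP.
  by rewrite -sum_dot_blk mulr_sumr; apply: ler_sum => l _; exact: IH.
have q4 := IH u; have U0 := dot_ge0 u.
move: incr; rewrite qform_gramian_op -/v1.
set U := dot u u in aa dh q1 q2 q3 q4 U0 *.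
set Sg := \sum_k _ in q3 *; move: qA q1 q2 q3 q4.
set b1 := bform X v1 u + _; move: b1 (qform X (u + h *: v1)) (qform X v1).
move: (qform X u) (qform Y u) (Sg) (U) U0 => qX qY sg V V0 b1 qX1 qX2.
move=> qA q1 q2 q3 q4 incr.
have p1 : h * (h * qX2) <= h * (e / 2 * V).
  apply: ler_wpM2l => //; apply: (le_trans (ler_wpM2l h0 q2)).
  by rewrite mulrA; apply: ler_wpM2r.
have p2 : h * (cL * w * V) <= h * (e / 2 * V).
  by apply: ler_wpM2l => //; apply: ler_wpM2r.
have p3 : a * (w * n%:R * V) <= a * (e / 2 * V).
  by apply: ler_wpM2l => //; apply: ler_wpM2r; rewrite // mulrC.
have p4 : h * (- (z * (cN * V))) <= h * sg by exact: ler_wpM2l.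
have p5 : a * (- z * V) <= a * qX by exact: ler_wpM2l.
have p6 : 0 <= (z - e) * (h * V).
  by apply: mulr_ge0; [rewrite subr_ge0|exact: mulr_ge0].
have p7 : 0 <= (z - e) * (a * V).
  by apply: mulr_ge0; [rewrite subr_ge0|exact: mulr_ge0].
have p8 : 0 <= e * (a * V).
  by apply: mulr_ge0; [exact: ltW|exact: mulr_ge0].
have p9 : 0 <= z * (h * V) * (2 * cA + cN).
  apply: mulr_ge0; last by apply: addr_ge0 => //; exact: mulr_ge0.
  by apply: mulr_ge0; [exact: ltW|exact: mulr_ge0].
have c1E : h * (b1 + sg - cL * w * V) = h * b1 + h * sg - h * (cL * w * V) by ring.
move: incr; rewrite c1E qA; lra.
Qed.

(** Iterating the step from an arbitrarily small lower bound [- e |v|^2], the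
    bound grows at most like [e expR (2 (C t + K t))], where [K] is the integral
    of [k]; then [e] tends to [0]. *)
Lemma psd_flow n m T (A : 'M[R]_n) (N : 'M[R]_(n, m * n)) (D D' : R -> 'M[R]_n)
    (k : R -> R) :
  mx_primitive T D D' -> psd (D 0) -> L1 T k ->
  (forall t, 0 <= t <= T -> 0 <= k t) ->
  (forall t, 0 <= t <= T -> forall v,
     qform (gramian_op A N (D t)) v + k t * qform (D t) v <= qform (D' t) v) ->
  forall t, 0 <= t <= T -> psd (D t).
Proof.
move=> DD' D0 ki k0 kD t tT v.
have [cA cA0 cAP] := dot_mulmx_bound A^T; have [cN cN0 cNP] := dot_mulmx_bound N^T.
have [cL cL0 cLP] := gramian_op_bound A N.
have [M M0 MP] := mx_primitive_bounded DD'.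
have [J [j [Jj JD]]] := mx_primitive_majorant DD'.
pose C := 1 + 2 * cA + cN.
have C1 : 1 <= C by rewrite /C; lra.
pose K t := \int[mu]_(s in `[0, t]) k s.
have Kk : primitive T K k := primitive_int ki.
have K0 : K 0 = 0 by exact: itg0.
pose Th t := expR (2 * (C * t + K t)).
have main e : 0 < e -> forall t, 0 <= t <= T ->
    forall v, - (e * Th t) * dot v v <= qform (D t) v.
  move=> e0 {}t {}tT.
  (* [w] bounds the oscillation of [D] over a step, [h0] the length of a step:
     both make the errors of the step at most [e / 2] in relative size *)
  pose w := e / (2 * (cL + n%:R + 1)).
  have cLn : 0 < 2 * (cL + n%:R + 1).
    by rewrite mulr_gt0// ltr_wpDl// addr_ge0.
  have w0 : 0 < w by rewrite divr_gt0.
  have nM : 0 < 2 * (n%:R * M * cA + 1) by rewrite mulr_gt0// ltr_wpDl// !mulr_ge0.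
  have [h1 h10 h1P] := primitive_unif_cont Jj w0.
  pose h0 := Num.min 1 (Num.min h1 (e / (2 * (n%:R * M * cA + 1)))).
  have h0_gt0 : 0 < h0 by rewrite !lt_min ltr01 h10 divr_gt0.
  have wL : (cL + n%:R) * w <= e / 2.
    have : 2 * (cL + n%:R + 1) * w = e by rewrite mulrC /w divfK// gt_eqF.
    by move: (ltW w0); clear; lra.
  have nw : n%:R * w <= e / 2.
    by apply: le_trans wL; apply: ler_wpM2r (ltW w0) _ _ _; rewrite lerDr.
  have lw : cL * w <= e / 2.
    by apply: le_trans wL; apply: ler_wpM2r (ltW w0) _ _ _; rewrite lerDl.
  move: t tT; apply: (step_induction h0_gt0).
    by move=> u; apply: le_trans (D0 u); rewrite mulNr oppr_le0 !mulr_ge0 ?expR_ge0 ?dot_ge0// ltW.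
  move=> s t s0 st tT; rewrite !lt_min => /and3P[th1 thh the] IH u.
  have sT : s <= T := le_trans st tT.
  have sI : 0 <= s <= T by rewrite s0.
  set h := t - s in th1 thh the.
  have hge0 : 0 <= h by rewrite subr_ge0.
  set a := \int[mu]_(x in `[s, t]) k x.
  have a0 : 0 <= a.
    apply: Rintegral_ge0 => x /=; rewrite in_itv /= => /andP[sx xt].
    by rewrite k0// (le_trans s0 sx) (le_trans xt tT).
  have cl r : s <= r <= t -> forall i j, `|D r i j - D s i j| <= w.
    move=> /andP[sr rt] i l; apply: (le_trans (JD _ _ s0 sr (le_trans rt tT) i l)).
    apply: (le_trans (ler_norm _)); apply/ltW/h1P => //.
      by rewrite (le_trans s0 sr) (le_trans rt tT).
    by rewrite ger0_norm ?subr_ge0// (le_lt_trans _ thh)// lerD2r.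
  (* the right-hand side is nearly constant over the step *)
  pose c1 := qform (gramian_op A N (D s)) u - cL * w * dot u u.
  pose c2 := qform (D s) u - w * n%:R * dot u u.
  have incr : h * c1 + a * c2 <= qform (D t) u - qform (D s) u.
    rewrite (primitive_sub (primitive_qform u DD') s0 st tT).
    have i1 : mu.-integrable `[s, t] (EFin \o (fun=> c1)).
      exact: L1_integrableS s0 tT (L1_cst T c1).
    have i2 : mu.-integrable `[s, t] (EFin \o (fun x => k x * c2)).
      apply: L1_integrableS s0 tT _.
      by apply: eq_L1 (L1Z c2 ki) => x _; rewrite mulrC.
    have -> : h * c1 + a * c2 = \int[mu]_(x in `[s, t]) (c1 + k x * c2).
      rewrite RintegralD// RintegralZr//; last exact: L1_integrableS s0 tT ki.
      congr (_ + _).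
      have := primitive_sub (primitive_int (L1_cst T c1)) s0 st tT.
      by move=> <-; rewrite !itg_cst ?(le_trans s0 st)// /h; ring.
    apply: le_Rintegral => //.
    - exact: (integrableD _ i1 i2).
    - exact: L1_integrableS s0 tT (primitive_L1 (primitive_qform u DD')).
    move=> x; rewrite /= in_itv /= => sxt; have /andP[sx xt] := sxt.
    have xT : 0 <= x <= T by rewrite (le_trans s0 sx) (le_trans xt tT).
    apply: le_trans (kD _ xT u); have Dx : D x = D s + (D x - D s) by rewrite addrC subrK.
    have clx i l : `|(D x - D s) i l| <= w.
      by rewrite mxE [X in _ + X]mxE; exact: cl.
    rewrite Dx qform_gramian_opD qformDm.
    have := cLP _ _ u clx; have := qform_le u clx; have := k0 _ xT.
    rewrite !ler_norml /c1 /c2 => kx /andP[p1 _] /andP[p2 _].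
    have : 0 <= k x * (qform (D x - D s) u + w * n%:R * dot u u).
      by rewrite mulr_ge0//; lra.
    lra.
  have U0 := dot_ge0 u.
  have ThP : 1 <= Th s.
    apply: le_trans (expR_ge1Dx _); rewrite lerDl mulr_ge0// addr_ge0//.
      by rewrite mulr_ge0// (le_trans _ C1).
    by apply: Rintegral_ge0 => x /=; rewrite in_itv /= => /andP[x0 xs]; rewrite k0// x0 (le_trans xs).
  have ze : e <= e * Th s by rewrite ler_peMr// ltW.
  have ThE : Th t = Th s * expR (2 * (C * h + a)).
    rewrite /Th -expRD; congr expR.
    have : K t - K s = a := primitive_sub Kk s0 st tT.
    by rewrite /h; clear; lra.
  have Ths : Th s * (1 + 2 * (C * h + a)) <= Th t.
    by rewrite ThE; apply: ler_wpM2l; [exact: expR_ge0|exact: expR_ge1Dx].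
  have Tht : e * Th s * (1 + 2 * (C * h + a)) <= e * Th t.
    by rewrite -mulrA; exact: ler_wpM2l (ltW e0) _ _ Ths.
  have hM : h * (n%:R * M * cA) <= e / 2.
    have : h * (2 * (n%:R * M * cA + 1)) <= e by rewrite -ler_pdivlMr// ltW.
    by move: hge0; clear; lra.
  apply: le_trans (psd_flow_step cA0 cN0 cAP cNP (MP _ sI) hge0 (ltW th1) a0 e0 ze
    lw nw hM (mulr_ge0 (ler0n _ _) M0) IH incr).
  by rewrite -/C !mulNr lerN2; apply: ler_wpM2r.
rewrite leNgt; apply/negP => neg.
have v0 : 0 < Th t * dot v v + 1 by rewrite ltr_wpDl// mulr_ge0 ?expR_ge0 ?dot_ge0.
have e0 : 0 < - qform (D t) v / 2 / (Th t * dot v v + 1).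
  by rewrite !divr_gt0// oppr_gt0.
have := main _ e0 _ tT v; apply/negP; rewrite -ltNge.
have S0 : 0 <= Th t * dot v v by rewrite mulr_ge0 ?expR_ge0 ?dot_ge0.
rewrite [ltRHS](_ : _ = qform (D t) v * (Th t * dot v v) /
    (2 * (Th t * dot v v + 1))); last by field; rewrite gt_eqF.
rewrite ltr_pdivlMr ?mulr_gt0//; nra.
Qed.

End positivity.

(** * The entrywise sum norm *)

Section sumnorm.
Context {R : realType}.

Lemma sumnorm0 p q : sumnorm (0 : 'M[R]_(p, q)) = 0.
Proof. by rewrite /sumnorm big1// => i _; rewrite big1// => j _; rewrite mxE normr0. Qed.

Lemma sumnormD p q (X Y : 'M[R]_(p, q)) : sumnorm (X + Y) <= sumnorm X + sumnorm Y.
Proof.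
rewrite /sumnorm -big_split; apply: ler_sum => i _.
by rewrite -big_split; apply: ler_sum => j _; rewrite mxE ler_normD.
Qed.

Lemma sumnormN p q (X : 'M[R]_(p, q)) : sumnorm (- X) = sumnorm X.
Proof.
by apply: eq_bigr => i _; apply: eq_bigr => j _; rewrite mxE normrN.
Qed.

Lemma sumnorm_sum p q (I : Type) (r : seq I) (P : pred I) (F : I -> 'M[R]_(p, q)) :
  sumnorm (\sum_(i <- r | P i) F i) <= \sum_(i <- r | P i) sumnorm (F i).
Proof.
elim/big_rec2: _ => [|i x y _ IH]; first by rewrite sumnorm0.
by apply: (le_trans (sumnormD _ _)); rewrite lerD2l.
Qed.

Lemma sumnormM p q r (X : 'M[R]_(p, q)) (Y : 'M[R]_(q, r)) :
  sumnorm (X *m Y) <= sumnorm X * sumnorm Y.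
Proof.
rewrite /sumnorm mulr_suml; apply: ler_sum => i _.
apply: (@le_trans _ _ (\sum_j \sum_k `|X i k| * `|Y k j|)).
  apply: ler_sum => j _; rewrite mxE; apply: (le_trans (ler_norm_sum _ _ _)).
  by apply: ler_sum => k _; rewrite normrM.
rewrite exchange_big mulr_suml; apply: ler_sum => k _ /=.
rewrite -mulr_sumr ler_wpM2l// [leRHS](bigD1 k)//= lerDl.
by apply: sumr_ge0 => ? _; exact: sumr_ge0.
Qed.

Lemma sumnorm_tens p q r s (X : 'M[R]_(p, q)) (Y : 'M[R]_(r, s)) :
  sumnorm (X *t Y) = sumnorm X * sumnorm Y.
Proof.
rewrite /sumnorm sum_mxtens_index mulr_suml; apply: eq_bigr => i _.
rewrite mulr_sumr; apply: eq_bigr => k _.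
rewrite sum_mxtens_index mulr_suml; apply: eq_bigr => j _.
by rewrite mulr_sumr; apply: eq_bigr => l _; rewrite tensmxE normrM.
Qed.

Lemma sumnorm_kron p q (a : 'cV[R]_p) (b : 'cV[R]_q) :
  sumnorm (kron_cv a b) = sumnorm a * sumnorm b.
Proof.
rewrite /sumnorm sum_mxtens_index mulr_suml; apply: eq_bigr => i _.
rewrite mulr_sumr; apply: eq_bigr => j _.
by rewrite !big_ord1 kron_cvE normrM.
Qed.

Lemma sumnorm_eq0 p q (X : 'M[R]_(p, q)) : sumnorm X <= 0 -> X = 0.
Proof.
move=> X0; apply/matrixP => i j; rewrite mxE; apply/normr0_eq0/le_anti.
by rewrite normr_ge0 (le_trans (le_sumnorm _ _ _) X0).
Qed.

End sumnorm.

(** * Matrix differential equations *)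

Section equations.
Context {R : realType}.
Local Notation mu := (@lebesgue_measure R).
Implicit Types T t e : R.

Lemma solution_primitive p q T f (y0 : 'M[R]_(p, q)) y : 0 <= T ->
  is_solution T f y0 y -> y 0 = y0 /\ mx_primitive T y (fun s => f s (y s)).
Proof.
move=> T0 [fi yE].
have y00 : y 0 = y0.
  by apply/matrixP => i j; rewrite yE ?lexx// !mxE itg0 addr0.
split=> // i j; split; first exact: fi.
by move=> t tT; rewrite y00 yE// !mxE.
Qed.

Lemma mx_primitiveB p q T (X X' Y Y' : R -> 'M[R]_(p, q)) :
  mx_primitive T X X' -> mx_primitive T Y Y' ->
  mx_primitive T (fun t => X t - Y t) (fun t => X' t - Y' t).
Proof.
move=> Xp Yp i j; apply: eq_primitive (primitiveB (Xp i j) (Yp i j)) => t _;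
  by rewrite !mxE.
Qed.

Lemma L1_sumnorm p q T (X X' : R -> 'M[R]_(p, q)) k : mx_primitive T X X' ->
  L1 T k -> L1 T (fun t => k t * sumnorm (X t)).
Proof.
move=> Xp ki.
apply: (@eq_L1 _ T (fun t => \sum_i \sum_j k t * `|X t i j|)).
  by move=> t _; rewrite mulr_sumr; apply: eq_bigr => i _; rewrite mulr_sumr.
apply: L1_sum => i _; apply: L1_sum => j _.
apply: (L1_le _ _ (L1_norm (L1M (Xp i j) ki))).
  apply: measurable_funM; first exact: L1_measurable.
  by apply: measurableT_comp => //; exact: primitive_measurable (Xp i j).
by move=> t _; rewrite !normrM normr_id mulrC.
Qed.

(** The scalar lemma, applied to the sum of the absolute values of the entries. *)
Lemma mx_gronwall p q T (X X' : R -> 'M[R]_(p, q)) (k : R -> R) :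
  mx_primitive T X X' -> X 0 = 0 -> L1 T k ->
  (forall t, 0 <= t <= T -> 0 <= k t) ->
  (forall t, 0 <= t <= T -> sumnorm (X' t) <= k t * sumnorm (X t)) ->
  forall t, 0 <= t <= T -> X t = 0.
Proof.
move=> Xp X0 ki k0 Xk t tT; apply: sumnorm_eq0.
apply: (gronwall (w := fun t => sumnorm (X t)) ki _ k0 _ tT); first exact: L1_sumnorm.
move=> {}t {}tT; have /andP[t0 tT'] := tT.
apply: (@le_trans _ _ (\int[mu]_(s in `[0, t]) sumnorm (X' s))).
  have Xi i j : L1 t (fun s => `|X' s i j|) by exact: L1S tT' (L1_norm (Xp i j).1).
  rewrite itg_sum; last by move=> i _; exact: L1_sum.
  apply: ler_sum => i _; rewrite itg_sum//; apply: ler_sum => j _.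
  have := primitive_dist (Xp i j) (lexx _) t0 tT'.
  by rewrite X0 mxE subr0.
apply: le_Rintegral => //.
- apply: L1S tT' _; apply: L1_sum => i _; apply: L1_sum => j _.
  exact: L1_norm (Xp i j).1.
- by apply: L1S tT' _; exact: L1_sumnorm.
- move=> x; rewrite /= in_itv /= => /andP[x0 xt].
  by apply: Xk; rewrite x0 (le_trans xt).
Qed.

Lemma gramian_op_sumnorm n m (A : 'M[R]_n) (N : 'M[R]_(n, m * n)) (X : 'M[R]_n) :
  sumnorm (gramian_op A N X) <=
  (sumnorm A + sumnorm A^T + sumnorm N * sumnorm (1%:M : 'M[R]_m) * sumnorm N^T) * sumnorm X.
Proof.
rewrite /gramian_op !mulrDl.
apply: (le_trans (sumnormD _ _)); apply: lerD.
  apply: (le_trans (sumnormD _ _)); apply: lerD; first exact: sumnormM.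
  by rewrite mulrC sumnormM.
apply: (le_trans (sumnormM _ _)).
rewrite -mulrA [sumnorm N^T * _]mulrC mulrA ler_wpM2r ?sumnorm_ge0//.
by apply: (le_trans (sumnormM _ _)); rewrite sumnorm_tens mulrA.
Qed.

Lemma gramian_op_sub n m (A : 'M[R]_n) (N : 'M[R]_(n, m * n)) (X Y : 'M[R]_n) :
  gramian_op A N (X - Y) = gramian_op A N X - gramian_op A N Y.
Proof.
have E : (1%:M : 'M[R]_m) *t (X - Y) = 1%:M *t X - 1%:M *t Y.
  by apply/matrixP => i j; rewrite !mxE mulrBr.
rewrite /gramian_op E !(mulmxBr, mulmxBl) !opprD !addrA.
by apply/matrixP => i j; rewrite !mxE; ring.
Qed.

Lemma gramian_op_tr n m (A : 'M[R]_n) (N : 'M[R]_(n, m * n)) (X : 'M[R]_n) :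
  (gramian_op A N X)^T = gramian_op A N X^T.
Proof.
rewrite /gramian_op !linearD /= !trmx_mul !trmxK trmx_tens trmx1 mulmxA.
by rewrite [A *m _ + _]addrC.
Qed.

(** The transpose solves the same linear equation. *)
Lemma gramian_flow_sym n m T (A : 'M[R]_n) (N : 'M[R]_(n, m * n)) G Z : 0 <= T ->
  is_solution T (fun _ => gramian_op A N) G Z -> G^T = G ->
  forall t, 0 <= t <= T -> (Z t)^T = Z t.
Proof.
move=> T0 /(solution_primitive T0)[Z0 Zp] Gs t tT.
have Ztp : mx_primitive T (fun t => (Z t)^T) (fun t => (gramian_op A N (Z t))^T).
  by move=> i j; apply: eq_primitive (Zp j i) => s _; rewrite [RHS]mxE.
apply/esym/eqP; rewrite -subr_eq0; apply/eqP.
pose c := sumnorm A + sumnorm A^T + sumnorm N * sumnorm (1%:M : 'M[R]_m) * sumnorm N^T.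
apply: (mx_gronwall (mx_primitiveB Zp Ztp) _ (L1_cst T c) _ _ tT).
- by rewrite Z0 Gs subrr.
- by move=> s _; rewrite /c !(addr_ge0, mulr_ge0, sumnorm_ge0).
- move=> s _; rewrite gramian_op_tr -gramian_op_sub; exact: gramian_op_sumnorm.
Qed.

Lemma gramian_flow_psd n m T (A : 'M[R]_n) (N : 'M[R]_(n, m * n)) G Z : 0 <= T ->
  is_solution T (fun _ => gramian_op A N) G Z -> psd G ->
  forall t, 0 <= t <= T -> psd (Z t).
Proof.
move=> T0 /(solution_primitive T0)[Z0 Zp] Gp.
apply: (psd_flow Zp (k := fun=> 0)); rewrite ?Z0//; first exact: L1_cst.
by move=> t _ v; rewrite mul0r addr0.
Qed.

Lemma mx_primitive_int n T (Z Z' : R -> 'M[R]_n) : mx_primitive T Z Z' ->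
  mx_primitive T (fun t => mx_integral `[0, t] Z) Z.
Proof.
move=> Zp i j; apply: eq_primitive (primitive_int (primitive_L1l (Zp i j))) => t _.
  by rewrite mxE.
by [].
Qed.

(** In short, [Z = G + L (int Z)] for the Gramian operator [L]: both sides are
    primitives of the same function. *)
Lemma gramian_flow_int n m T (A : 'M[R]_n) (N : 'M[R]_(n, m * n)) G Z : 0 <= T ->
  is_solution T (fun _ => gramian_op A N) G Z ->
  forall t v, 0 <= t <= T -> qform (Z t) v =
    qform G v + qform (gramian_op A N (mx_integral `[0, t] Z)) v.
Proof.
move=> T0 /(solution_primitive T0)[Z0 Zp] t v tT.
have Wp := mx_primitive_int Zp.
have [_ ->//] := primitive_qform v Zp; rewrite Z0; congr (_ + _).
rewrite qform_gramian_op.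
have H : primitive T (fun t => bform (mx_integral `[0, t] Z) (A^T *m v) v +
    bform (mx_integral `[0, t] Z) v (A^T *m v) +
    \sum_k qform (mx_integral `[0, t] Z) (blk (N^T *m v) k))
   (fun t => bform (Z t) (A^T *m v) v + bform (Z t) v (A^T *m v) +
    \sum_k qform (Z t) (blk (N^T *m v) k)).
  apply: primitiveD; last by apply: primitive_sum => k _; exact: primitive_qform.
  by apply: primitiveD; exact: primitive_bform.
have [_ ->//] := H.
have -> : mx_integral `[0, 0] Z = 0 by apply/matrixP => i j; rewrite !mxE itg0.
rewrite /bform !mul0mx !dot0r !add0r big1 ?add0r.
  by apply: eq_itg => s _; rewrite qform_gramian_op.
by move=> k _; rewrite qform0m.
Qed.

Lemma gramian_int_psd n T (Z Z' : R -> 'M[R]_n) : 0 <= T -> mx_primitive T Z Z' ->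
  (forall t, 0 <= t <= T -> psd (Z t)) -> psd (mx_integral `[0, T] Z).
Proof.
move=> T0 Zp Zpsd v.
have := primitive_le (primitive_qform v (mx_primitive_int Zp)) _ (lexx _) T0 (lexx _).
have -> : mx_integral `[0, 0] Z = 0 by apply/matrixP => i j; rewrite !mxE itg0.
by rewrite qform0m; apply => t tT; exact: Zpsd.
Qed.

Lemma ler_mul_addeps (x p q d : R) : 0 <= p -> 0 <= q ->
  (forall e, 0 < e -> x <= p * (e + d) * q) -> x <= p * d * q.
Proof.
move=> p0 q0 xe; apply/ler_addgt0Pr => e e0.
have c0 : 0 <= p * q := mulr_ge0 p0 q0.
have d0 : 0 < e / (p * q + 1) by rewrite divr_gt0// ltr_wpDl.
apply: (le_trans (xe _ d0)).
have : e / (p * q + 1) * (p * q) <= e.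
  by rewrite mulrAC ler_pdivrMr ?ltr_wpDl// ler_pM2l// lerDl.
by lra.
Qed.

(** With [r = e + int rho], [E = expR (int |a|^2)] and [W] the integral of [Z], the
    matrix [E r W - y y^T] satisfies the differential inequality of [psd_flow] for
    [k = |a|^2 + rho / r].  In the derivative of [y y^T], the terms with [g] are
    absorbed by [r G + (rho / r) y y^T], and the terms bilinear in [a] and [y] by
    [|a|^2 y y^T] and the [N_k y y^T N_k^T]. *)
Lemma forced_estimate n m T (A : 'M[R]_n) (N : 'M[R]_(n, m * n)) (a : R -> 'cV[R]_m)
    (g y : R -> 'cV[R]_n) G (Z : R -> 'M[R]_n) (rho : R -> R) : 0 <= T ->
  L1 T (fun s => dot (a s) (a s)) -> L1 T rho ->
  (forall t, 0 <= t <= T -> 0 <= rho t) ->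
  mx_primitive T y (fun s => A *m y s + N *m kron_cv (a s) (y s) + g s) ->
  y 0 = 0 -> is_solution T (fun _ => gramian_op A N) G Z -> psd G ->
  (forall t, 0 <= t <= T -> forall v, dot v (g t) ^+ 2 <= rho t * qform G v) ->
  forall t, 0 <= t <= T -> forall v,
    dot v (y t) ^+ 2 <= expR (\int[mu]_(s in `[0, T]) dot (a s) (a s)) *
      (\int[mu]_(s in `[0, t]) rho s) * qform (mx_integral `[0, T] Z) v.
Proof.
move=> T0 ai rhoi rho0 yp y0 Zs Gp gG.
have Zpsd := gramian_flow_psd T0 Zs Gp.
have Zint := gramian_flow_int T0 Zs.
have [Z0 Zp] := solution_primitive T0 Zs.
have Wp := mx_primitive_int Zp; pose W t := mx_integral `[0, t] Z.
have W0 : W 0 = 0 by apply/matrixP => i j; rewrite !mxE itg0.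
have Ep := primitive_expR (primitive_int ai).
set phi := fun t => \int[mu]_(s in `[0, t]) dot (a s) (a s) in Ep.
have phi0 t : 0 <= phi t by apply: Rintegral_ge0 => x _; exact: dot_ge0.
have E1 t : 1 <= expR (phi t).
  by apply: le_trans (expR_ge1Dx _); rewrite lerDl.
pose I t := \int[mu]_(s in `[0, t]) rho s.
have I0 t : 0 <= t <= T -> 0 <= I t.
  move=> /andP[t0 tT]; apply: Rintegral_ge0 => x; rewrite /= in_itv /= => /andP[x0 xt].
  by rewrite rho0// x0 (le_trans xt).
have main e : 0 < e -> forall t, 0 <= t <= T -> forall v,
    dot v (y t) ^+ 2 <= expR (phi t) * (e + I t) * qform (W t) v.
  move=> e0.
  (* [e > 0] keeps [r = e + I] away from [0], where [rho / r] is to be formed *)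
  have rp := primitiveD (primitive_cst T e) (primitive_int rhoi).
  have Ip : primitive T (fun t => expR (phi t) * (e + I t)) (fun t =>
      expR (phi t) * (dot (a t) (a t) * (e + I t) + rho t)).
    apply: eq_primitive (primitiveM Ep rp) => t _; first by [].
    by rewrite add0r -/(I t); ring.
  pose r t := e + I t.
  have r_gt0 t : 0 <= t <= T -> 0 < r t by move=> tT; rewrite ltr_wpDr// I0.
  pose Q t := expR (phi t) * r t.
  pose y' s := A *m y s + N *m kron_cv (a s) (y s) + g s.
  pose D t := Q t *: W t - y t *m (y t)^T.
  pose D' t := (expR (phi t) * (dot (a t) (a t) * r t + rho t)) *: W t + Q t *: Z t -
    (y' t *m (y t)^T + y t *m (y' t)^T).
  have DD' : mx_primitive T D D'.
    move=> i j.
    apply: eq_primitive (primitiveB (primitiveM Ip (Wp i j))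
                           (primitiveM (yp i 0) (yp j 0))) => t _.
      by rewrite /D /W !mxE big_ord1 !mxE.
    by rewrite /D' [RHS]mxE [X in _ = X + _]mxE [X in _ = X + _ + _]mxE
      [X in _ = _ + X + _]mxE [X in _ = _ + X]mxE [X in _ = _ - X]mxE
      [X in _ = _ - (X + _)]mxE [X in _ = _ - (_ + X)]mxE !big_ord1
      [(y t)^T _ _]mxE [(y' t)^T _ _]mxE.
  pose k t := dot (a t) (a t) + rho t / r t.
  have ri : L1 T (fun t => rho t / r t).
    apply: (L1_le _ _ (L1Z e^-1 rhoi)).
      apply: measurable_funM; first exact: L1_measurable.
      have -> : (fun t => (r t)^-1) = GRing.inv \o r by [].
      apply: (measurable_comp (F := `]0, +oo[%classic : set R)) => //.
      - by move=> _ [t tT <-]; rewrite /= in_itv /= andbT r_gt0//; move: tT; rewrite /= in_itv.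
      - apply: open_continuous_measurable_fun; first exact: interval_open.
        move=> x; rewrite inE /= in_itv /= andbT => x0.
        by apply: inv_continuous; rewrite gt_eqF.
      - exact: primitive_measurable rp.
    move=> t tT; rewrite ger0_norm ?divr_ge0 ?rho0 ?(ltW (r_gt0 _ tT))//.
    rewrite mulrC ler_wpM2r ?rho0// lef_pV2 ?posrE ?r_gt0//.
    by rewrite lerDl I0.
  have := psd_flow DD' (A := A) (N := N) (k := k).
  have -> : D 0 = 0 by rewrite /D W0 y0 scaler0 mul0mx subrr.
  have p0 : psd (0 : 'M[R]_n) by move=> u; rewrite qform0m.
  move=> /(_ p0).
  move=> /(_ (L1D ai ri)) H t tT v.
  suff : psd (D t).
    by move=> /(_ v); rewrite qformDm qformZm -scaleN1r qformZm qform_col mulN1r subr_ge0.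
  apply: H tT => {}t {}tT; first by rewrite /k addr_ge0 ?dot_ge0// divr_ge0 ?rho0// ltW// r_gt0.
  move=> {}v.
  have rt := r_gt0 _ tT; have Et := E1 t.
  have WE := Zint t v tT; rewrite -/(W t) in WE.
  pose p := dot v (y t); pose b l := dot (blk (N^T *m v) l) (y t).
  have LyE : qform (gramian_op A N (y t *m (y t)^T)) v =
      2 * dot (A^T *m v) (y t) * p + \sum_l b l ^+ 2.
    rewrite qform_gramian_op !bform_outer -/p.
    by under eq_bigr do rewrite qform_col; rewrite /b; ring.
  have LWE : qform (gramian_op A N (Q t *: W t)) v =
      Q t * qform (gramian_op A N (W t)) v.
    rewrite !qform_gramian_op !bformZm.
    by under eq_bigr do rewrite qformZm; rewrite -mulr_sumr; ring.
  have y'E : dot v (y' t) =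
      dot (A^T *m v) (y t) + \sum_l a t l 0 * b l + dot v (g t).
    by rewrite !dotDr !dot_mulmx dot_kron.
  have D'E : qform (D' t) v =
      expR (phi t) * (dot (a t) (a t) * r t + rho t) * qform (W t) v +
      Q t * qform (Z t) v - 2 * dot v (y' t) * p.
    have O x z : qform (x *m z^T) v = dot v x * dot v z := bform_outer x z v v.
    by rewrite qformBm !qformDm !qformZm !O -/p; ring.
  have sq1 : 0 <= \sum_l b l ^+ 2 - 2 * p * (\sum_l a t l 0 * b l) +
      p ^+ 2 * dot (a t) (a t).
    have sqE (q : R) (c d : 'I_m -> R) : \sum_l c l ^+ 2 -
        2 * q * (\sum_l d l * c l) + q ^+ 2 * (\sum_l d l * d l) =
        \sum_l (c l - q * d l) ^+ 2.
      rewrite !mulr_sumr -sumrB -big_split.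
      by apply: eq_bigr => l _ /=; ring.
    rewrite sqE.
    by apply: sumr_ge0 => l _; exact: sqr_ge0.
  have sq2 : 2 * (p * dot v (g t)) <= Q t * qform G v + rho t / r t * p ^+ 2.
    apply: (@le_trans _ _ (r t * qform G v + rho t / r t * p ^+ 2)).
      apply: amgm2.
      - by rewrite mulr_ge0// ltW.
      - by rewrite mulr_ge0 ?sqr_ge0// divr_ge0 ?rho0// ltW.
      rewrite exprMn (_ : _ * _ * _ = p ^+ 2 * (rho t * qform G v)).
        by rewrite ler_wpM2l ?sqr_ge0// gG.
      by field; rewrite gt_eqF.
    rewrite lerD2r ler_wpM2r//; by rewrite ler_peMl// ltW.
  have kQ : k t * Q t = expR (phi t) * (dot (a t) (a t) * r t + rho t).
    by rewrite /k /Q; field; rewrite gt_eqF.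
  rewrite D'E WE /D gramian_op_sub qformBm LWE LyE qformBm qformZm qform_col -/p y'E.
  rewrite -kQ /k; move: sq1 sq2; rewrite -/p; lra.
move=> t tT v; have /andP[t0 tT'] := tT.
have WT : qform (W t) v <= qform (W T) v.
  apply: (primitive_le (primitive_qform v Wp)) => // x xT.
  exact: Zpsd.
have W0t : 0 <= qform (W t) v.
  have := primitive_le (primitive_qform v Wp) _ (lexx _) t0 tT'.
  by rewrite -/(W 0) W0 qform0m; apply => x xT; exact: Zpsd.
have ET : expR (phi t) <= expR (phi T).
  rewrite ler_expR; apply: (primitive_le (primitive_int ai)) => // x _.
  exact: dot_ge0.
have WT0 : 0 <= qform (W T) v := le_trans W0t WT.
apply: (ler_mul_addeps (ltW (expR_gt0 _)) WT0) => e e0.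
have r0 : 0 <= e + I t by apply: addr_ge0 (ltW e0) (I0 _ tT).
have p1 : 0 <= expR (phi t) * (e + I t) := mulr_ge0 (ltW (expR_gt0 _)) r0.
have p2 : expR (phi t) * (e + I t) <= expR (phi T) * (e + I t).
  exact: ler_wpM2r r0 _ _ ET.
exact: le_trans (main _ e0 _ tT v) (ler_pM p1 W0t p2 WT).
Qed.

End equations.

(** * Tree integrals *)

Section lebesgue_tuple_integral.
Context {R : realType}.
Local Notation RT := (measurableTypeR R).
Local Open Scope ereal_scope.

Lemma integral_lebesgue_tuple0 (f : 0.-tuple RT -> \bar R) :
  \int[lebesgue_tuple 0]_p f p = f [tuple].
Proof.
have mf : measurable_fun setT f.
  move=> _ Y mY; rewrite setTI.
  have [h|h] := pselect (Y (f [tuple])).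
    by rewrite (_ : _ @^-1` _ = setT)//; apply/seteqP; split=> // x _ /=; rewrite tuple0.
  by rewrite (_ : _ @^-1` _ = set0)//; apply/seteqP; split=> // x /=; rewrite tuple0.
by rewrite /= integral_dirac//= diracT mul1e.
Qed.

(** Tonelli's theorem, after unfolding the pushforward that defines the measure. *)
Lemma integral_lebesgue_tupleS k (f : k.+1.-tuple RT -> \bar R) :
  measurable_fun setT f -> (forall p, 0 <= f p) ->
  \int[lebesgue_tuple k.+1]_p f p =
  \int[lebesgue_measure]_x \int[lebesgue_tuple k]_p f (tuple_cons (x, p)).
Proof.
move=> mf f0.
have mc := @measurable_tuple_cons R k.
have mfc : measurable_fun setT (f \o @tuple_cons R k) by exact: measurableT_comp.
rewrite -(fubini_tonelli1 (f \o @tuple_cons R k))//=.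
by rewrite (ge0_integral_pushforward mc)//; exact: in1W.
Qed.

(** Integrands are functions of sequences, not of tuples, because sequences can
    be cut at the boundary between two subtrees without casts. *)
Fixpoint iter_integral (k : nat) (f : seq R -> \bar R) : \bar R :=
  if k is k'.+1 then
    \int[lebesgue_measure]_x iter_integral k' (fun s => f (x :: s))
  else f [::].

Definition tmeasurable (f : seq R -> \bar R) :=
  forall k, measurable_fun setT (fun p : k.-tuple RT => f p).

Lemma tmeasurable_cons f x : tmeasurable f -> tmeasurable (fun s => f (x :: s)).
Proof.
move=> mf k; apply: (measurableT_comp (mf k.+1) (f := _)
  (g := fun p : k.-tuple RT => tuple_cons (x, p))).
exact: measurableT_comp (@measurable_tuple_cons R k) (measurable_pair1 x).
Qed.

Lemma iter_integralE k f : (forall s, 0 <= f s) -> tmeasurable f ->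
  \int[lebesgue_tuple k]_p f p = iter_integral k f.
Proof.
elim: k f => [|k IH] f f0 mf; first by rewrite integral_lebesgue_tuple0.
rewrite integral_lebesgue_tupleS//=.
  by apply: eq_integral => x _; rewrite -IH//; exact: tmeasurable_cons.
Qed.

Lemma iter_integral_ge0 k f : (forall s, 0 <= f s) -> 0 <= iter_integral k f.
Proof.
elim: k f => [|k IH] f f0 /=; first exact: f0.
by apply: integral_ge0 => x _; apply: IH => s; exact: f0.
Qed.

Lemma iter_integralZ k c f : 0 <= c -> (forall s, 0 <= f s) -> tmeasurable f ->
  iter_integral k (fun s => c * f s) = c * iter_integral k f.
Proof.
move=> c0 f0 mf; rewrite -!iter_integralE//.
- by rewrite ge0_integralZl//; exact: mf.
- by move=> s; rewrite mule_ge0.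
- move=> j; apply: emeasurable_funM => //; exact: mf.
Qed.

Lemma measurable_iter_integral k f : (forall s, 0 <= f s) -> tmeasurable f ->
  measurable_fun setT (fun x : RT => iter_integral k (fun s => f (x :: s))).
Proof.
move=> f0 mf.
apply: (eq_measurable_fun (fun x => \int[lebesgue_tuple k]_p f (x :: p))).
  by move=> x _; rewrite -iter_integralE//; exact: tmeasurable_cons.
apply: (measurable_fun_fubini_tonelli_F (m2 := @lebesgue_tuple R k)
  (fun xp : RT * k.-tuple RT => f (xp.1 :: xp.2))) => //.
apply: (measurableT_comp (mf k.+1) (g := @tuple_cons R k)).
exact: measurable_tuple_cons.
Qed.

Lemma iter_integral_cat a b f g : (forall s, 0 <= f s) -> (forall s, 0 <= g s) ->
  tmeasurable f -> tmeasurable g ->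
  iter_integral (a + b) (fun s => f (take a s) * g (drop a s)) =
  iter_integral a f * iter_integral b g.
Proof.
move=> + g0 + mg; elim: a f => [|a IH] f f0 mf /=.
  under [X in iter_integral _ X]eq_fun do rewrite take0 drop0.
  exact: iter_integralZ.
rewrite -ge0_integralZr//.
- apply: eq_integral => x _; rewrite -IH//; exact: tmeasurable_cons.
- exact: measurable_iter_integral.
- by move=> x _; exact: iter_integral_ge0.
- exact: iter_integral_ge0.
Qed.

(** From the definition of the integral as a supremum over the simple functions
    below the integrand. *)
Lemma ge0_integral_mono d (X : measurableType d) (m : {measure set X -> \bar R})
    (f g : X -> \bar R) : (forall x, 0 <= f x) -> (forall x, f x <= g x) ->
  \int[m]_x f x <= \int[m]_x g x.
Proof.
move=> f0 fg; rewrite !ge0_integralTE//; last by move=> x; exact: le_trans (fg x).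
apply: ereal_sup_le => _ [h hf <-]; exists h => // x; exact: le_trans (fg x).
Qed.

End lebesgue_tuple_integral.

Section trees.
Context {R : realType}.
Local Notation RT := (measurableTypeR R).
Local Notation mu := (@lebesgue_measure R).
Implicit Types (w : R -> R) (t : R) (tau : tree).

Lemma nb_nodes_Graft l r : nb_nodes (Graft l r) = (nb_nodes l + nb_nodes r).+1.
Proof. by rewrite /nb_nodes /= size_cat !size_map. Qed.

(** A recursive form of the integrand of [tree_energy], extended by zero.  In
    [s] the root comes first, then the nodes of the left subtree, then those of
    the right one; the value at the root is the time bound for both subtrees. *)
Fixpoint tree_kernel w tau t (s : seq R) : R :=
  let x := nth 0 s 0 in
  if (0 <= x) && (x <= t) then
    if tau is Graft l r then
      tree_kernel w l x (take (nb_nodes l) (behead s)) *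
      tree_kernel w r x (drop (nb_nodes l) (behead s))
    else w x
  else 0.

Lemma tree_kernel_ge0 w tau t s : (forall x, 0 <= w x) -> 0 <= tree_kernel w tau t s.
Proof.
move=> w0; elim: tau t s => [|l IHl r IHr] t s /=; case: ifP => // _.
by rewrite mulr_ge0.
Qed.

Definition measurable_coords d (X : measurableType d) (s : X -> seq R) :=
  forall i, measurable_fun setT (fun x => nth 0 (s x) i : RT).

Lemma measurable_tree_kernel d (X : measurableType d) w tau (t : X -> R) s :
  measurable_fun setT w -> measurable_fun setT t -> measurable_coords s ->
  measurable_fun setT (fun x => tree_kernel w tau (t x) (s x)).
Proof.
move=> mw; elim: tau t s => [|l IHl r IHr] t s mt ms /=.
  apply: measurable_fun_ifT => //; last exact: measurableT_comp (ms 0%N).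
  by apply: measurable_and; apply: measurable_fun_ler => //; exact: (ms 0%N).
apply: measurable_fun_ifT => //.
  by apply: measurable_and; apply: measurable_fun_ler => //; exact: (ms 0%N).
apply: measurable_funM.
- apply: IHl; first exact: (ms 0%N).
  move=> i; have [il|li] := ltnP i (nb_nodes l).
    under eq_fun do rewrite nth_take// nth_behead; exact: ms.
  under eq_fun do rewrite nth_default ?size_take_min ?geq_min ?li//.
  exact: measurable_cst.
- apply: IHr; first exact: (ms 0%N).
  by move=> i; under eq_fun do rewrite nth_drop nth_behead; exact: ms.
Qed.

Lemma tmeasurable_tree_kernel w tau t : measurable_fun setT w ->
  tmeasurable (fun s => (tree_kernel w tau t s)%:E).
Proof.
move=> mw k; apply/measurable_EFinP; apply: measurable_tree_kernel => //.
move=> i; have [ik|ki] := ltnP i k.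
  apply: (eq_measurable_fun (fun p : k.-tuple RT => tnth p (Ordinal ik))).
    by move=> p _; rewrite (tnth_nth 0).
  exact: measurable_tnth.
apply: (eq_measurable_fun (cst (0 : R) : k.-tuple RT -> RT)) => //.
by move=> p _; rewrite nth_default// size_tuple.
Qed.

Fixpoint tree_integral w tau t : R :=
  if tau is Graft l r then
    \int[mu]_(x in `[0, t]) (tree_integral w l x * tree_integral w r x)
  else \int[mu]_(x in `[0, t]) w x.

Fixpoint tree_density w tau t : R :=
  if tau is Graft l r then tree_integral w l t * tree_integral w r t else w t.

Lemma tree_integralE w tau t :
  tree_integral w tau t = \int[mu]_(x in `[0, t]) tree_density w tau x.
Proof. by case: tau. Qed.

Lemma tree_primitive T w tau : L1 T w ->
  primitive T (tree_integral w tau) (tree_density w tau).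
Proof.
move=> wi; elim: tau => [|l IHl r IHr]; first exact: primitive_int.
by apply: primitive_int; exact: L1M IHl (primitive_L1l IHr).
Qed.

Lemma tree_integral_ge0 w tau t : (forall x, 0 <= w x) -> 0 <= tree_integral w tau t.
Proof.
move=> w0; elim: tau t => [|l IHl r IHr] t /=; first exact: Rintegral_ge0.
by apply: Rintegral_ge0 => x _; rewrite mulr_ge0.
Qed.

Lemma iter_integral_tree T w tau t : (forall x, 0 <= w x) -> measurable_fun setT w ->
  L1 T w -> 0 <= t <= T ->
  iter_integral (nb_nodes tau) (fun s => (tree_kernel w tau t s)%:E) =
  (tree_integral w tau t)%:E.
Proof.
move=> w0 mw wi; elim: tau t => [|l IHl r IHr] t tT.
  rewrite /= /Rintegral fineK; last first.
    by apply: integrable_fin_num => //; case/andP: tT => _ /L1S; apply.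
  rewrite [RHS]integral_mkcond; apply: eq_integral => x _ /=.
  by rewrite patchE mem_setE in_itv /=; case: ifP.
rewrite nb_nodes_Graft [LHS]/= [in RHS]/= /Rintegral fineK; last first.
  apply: integrable_fin_num => //; have /andP[_ tT'] := tT.
  apply: L1S tT' _.
  exact: L1M (tree_primitive l wi) (primitive_L1l (tree_primitive r wi)).
rewrite [RHS]integral_mkcond; apply: eq_integral => x _ /=.
rewrite patchE mem_setE in_itv /=; case: ifPn => [xt|_]; last first.
  rewrite -iter_integralE//.
  exact: integral0.
have xT : 0 <= x <= T.
  by case/andP: xt => -> /le_trans; apply; case/andP: tT.
rewrite EFinM -IHl// -IHr// -iter_integral_cat//.
- by move=> s; rewrite lee_fin tree_kernel_ge0.
- by move=> s; rewrite lee_fin tree_kernel_ge0.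
- exact: tmeasurable_tree_kernel.
- exact: tmeasurable_tree_kernel.
Qed.

Lemma nil_nodes tau : [::] \in nodes tau.
Proof. by case: tau. Qed.

Lemma cons_inj (b : bool) : injective (cons b).
Proof. by move=> x y []. Qed.

Lemma parent_cons b v : v != [::] -> parent (b :: v) = b :: parent v.
Proof. by case: v. Qed.

Lemma mem_nodes_left l r v : (false :: v \in nodes (Graft l r)) = (v \in nodes l).
Proof.
rewrite /= in_cons mem_cat /= mem_map; last exact: cons_inj.
by rewrite orbC; case: mapP => [[]//|].
Qed.

Lemma mem_nodes_right l r v : (true :: v \in nodes (Graft l r)) = (v \in nodes r).
Proof.
rewrite /= in_cons mem_cat /= [X in _ || X]mem_map; last exact: cons_inj.
by case: mapP => [[]//|].
Qed.

Variant nodes_Graft_spec (l r : tree) : node -> Type :=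
| NodesRoot : nodes_Graft_spec l r [::]
| NodesLeft v of v \in nodes l : nodes_Graft_spec l r (false :: v)
| NodesRight v of v \in nodes r : nodes_Graft_spec l r (true :: v).

Lemma nodes_GraftP l r v : v \in nodes (Graft l r) -> nodes_Graft_spec l r v.
Proof.
case: v => [|[] v]; first by constructor.
- by rewrite mem_nodes_right; constructor.
- by rewrite mem_nodes_left; constructor.
Qed.

Lemma parent_nodes tau v : v \in nodes tau -> parent v \in nodes tau.
Proof.
elim: tau v => [|l IHl r IHr] v; first by rewrite /= inE => /eqP ->.
move=> /nodes_GraftP[|{}v vl|{}v vr]; first exact: nil_nodes.
- have [->|v0] := eqVneq v [::]; first exact: nil_nodes.
  by rewrite parent_cons// mem_nodes_left IHl.
- have [->|v0] := eqVneq v [::]; first exact: nil_nodes.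
  by rewrite parent_cons// mem_nodes_right IHr.
Qed.

Lemma leaves_Graft l r : leaves (Graft l r) =
  [seq false :: v | v <- leaves l] ++ [seq true :: v | v <- leaves r].
Proof.
have child b tau v : has (fun w : node => (w != [::]) && (parent w == b :: v))
      [seq b :: v | v <- nodes tau] =
    has (fun w : node => (w != [::]) && (parent w == v)) (nodes tau).
  rewrite has_map; apply: eq_has => -[|c w] //=.
  by rewrite eqseq_cons eqxx.
have other b c tau v : b != c -> has (fun w : node => (w != [::]) && (parent w == b :: v))
      [seq c :: v | v <- nodes tau] = false.
  move=> bc; apply/hasPn => _ /mapP[w _ ->] /=.
  by case: w => //= d w; rewrite eqseq_cons eq_sym (negbTE bc).
have root b tau : has (fun w : node => (w != [::]) && (parent w == [::]))
      [seq b :: v | v <- nodes tau].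
  by apply/hasP; exists [:: b] => //; apply/mapP; exists [::] => //; exact: nil_nodes.
rewrite /leaves /= has_cat root /= filter_cat !filter_map.
congr (_ ++ _); congr map; apply: eq_filter => v /=.
  by rewrite has_cat child other// orbF.
by rewrite has_cat child other.
Qed.

Lemma index_left l r v : v \in nodes l ->
  index (false :: v) (nodes (Graft l r)) = (index v (nodes l)).+1.
Proof.
move=> vl /=; rewrite index_cat mem_map; last exact: cons_inj.
by rewrite vl index_map//; exact: cons_inj.
Qed.

Lemma index_right l r v :
  index (true :: v) (nodes (Graft l r)) = (nb_nodes l + index v (nodes r)).+1.
Proof.
rewrite /= index_cat; case: mapP => [[]//|_].
by rewrite size_map index_map//; exact: cons_inj.
Qed.

(** Passes from the recursion on the tree to the paths that name its nodes: the
    index of a node of a subtree is shifted by the nodes that precede it. *)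
Lemma tree_kernel_support w tau t s (c := fun v => nth 0 s (index v (nodes tau))) :
  tree_kernel w tau t s != 0 ->
  (forall v, v \in nodes tau ->
     [/\ 0 <= c v, c v <= t & v != [::] -> c v <= c (parent v)]) /\
  tree_kernel w tau t s = \prod_(l <- leaves tau) w (c l).
Proof.
rewrite {}/c; elim: tau t s => [|l IHl r IHr] t s.
  rewrite /=; case: ifP => [/andP[x0 xt] _|_]; last by rewrite eqxx.
  split; last by rewrite /leaves /= big_seq1.
  by move=> v; rewrite inE => /eqP ->.
set x := nth 0 s 0; rewrite [tree_kernel _ _ _ _]/= -/x.
case: ifP => [/andP[x0 xt]|_]; last by rewrite eqxx.
rewrite mulf_eq0 negb_or => /andP[/IHl[Dl El] /IHr[Dr Er]].
pose c v := nth 0 s (index v (nodes (Graft l r))).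
have cl v : v \in nodes l -> c (false :: v) =
    nth 0 (take (nb_nodes l) (behead s)) (index v (nodes l)).
  by move=> vl; rewrite nth_take ?index_mem// nth_behead /c index_left.
have cr v : v \in nodes r -> c (true :: v) =
    nth 0 (drop (nb_nodes l) (behead s)) (index v (nodes r)).
  by move=> vr; rewrite nth_drop nth_behead /c index_right.
split.
  move=> v /nodes_GraftP[|{}v vl|{}v vr]; first by split.
  - rewrite -!/(c _) cl//; have [h1 h2 h3] := Dl _ vl; split=> //.
      exact: le_trans xt.
    have [v0|v0] := eqVneq v [::]; first by rewrite v0 /= in h2 *.
    by rewrite parent_cons// cl ?parent_nodes// => _; exact: h3.
  - rewrite -!/(c _) cr//; have [h1 h2 h3] := Dr _ vr; split=> //.
      exact: le_trans xt.
    have [v0|v0] := eqVneq v [::]; first by rewrite v0 /= in h2 *.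
    by rewrite parent_cons// cr ?parent_nodes// => _; exact: h3.
rewrite leaves_Graft big_cat !big_map El Er; congr (_ * _).
- rewrite big_seq [RHS]big_seq; apply: eq_bigr => v.
  by rewrite mem_filter => /andP[_ vl]; rewrite -cl.
- rewrite big_seq [RHS]big_seq; apply: eq_bigr => v.
  by rewrite mem_filter => /andP[_ vr]; rewrite -cr.
Qed.

Lemma enorm_sqr n (v : 'cV[R]_n) : enorm v ^+ 2 = dot v v.
Proof.
rewrite sqr_sqrtr; last by apply: sumr_ge0 => i _; exact: sqr_ge0.
by apply: eq_bigr => i _; rewrite expr2.
Qed.

Lemma L2_L1 T n (u : R -> 'cV[R]_n) : is_L2 T u -> L1 T (fun s => dot (u s) (u s)).
Proof.
move=> [mu_ ufin]; apply/integrableP; split.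
  apply/measurable_EFinP; apply: measurable_sum => i.
  exact: measurable_funM (mu_ i) (mu_ i).
apply: le_lt_trans ufin; rewrite le_eqVlt; apply/orP; left; apply/eqP.
by apply: eq_integral => s _ /=; rewrite enorm_sqr ger0_norm ?dot_ge0.
Qed.

(** The kernel lies below the integrand, and its integral is computed recursively
    by Tonelli's theorem.  The function [w] extends the squared norm of [u] by
    zero, since [u] is measurable on [[0, T]] only. *)
Lemma tree_integral_le_energy T n (u : R -> 'cV[R]_n) tau : 0 < T -> is_L2 T u ->
  ((tree_integral (fun s => dot (u s) (u s)) tau T)%:E <= tree_energy T u tau)%E.
Proof.
move=> T0 uL2; pose v s := dot (u s) (u s); pose w := v \_ `[0, T].
have vi : L1 T v := L2_L1 uL2.
have wv t : 0 <= t <= T -> w t = v t.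
  by move=> tT; rewrite /w patchE mem_setE in_itv /= tT.
have w0 t : 0 <= w t.
  by rewrite /w patchE; case: ifP => _ //; exact: dot_ge0.
have wi : L1 T w by apply: eq_L1 vi => t tT; rewrite wv.
have mw : measurable_fun setT w.
  by apply/(measurable_restrictT _ _).1 => //; exact: L1_measurable vi.
have -> : tree_integral v tau T = tree_integral w tau T.
  suff H t : 0 <= t <= T -> tree_integral v tau t = tree_integral w tau t.
    by rewrite H// lexx ltW.
  elim: tau t => [|l IHl r IHr] t /andP[t0 tT] /=.
    by apply: eq_itg => x /andP[x0 xt]; rewrite wv// x0 (le_trans xt).
  apply: eq_itg => x /andP[x0 xt]; have xT : 0 <= x <= T by rewrite x0 (le_trans xt).
  by rewrite IHl ?IHr.
have TT : 0 <= T <= T by rewrite lexx ltW.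
rewrite -(iter_integral_tree _ w0 mw wi TT).
rewrite -iter_integralE; last 2 first.
- by move=> s; rewrite lee_fin tree_kernel_ge0.
- exact: tmeasurable_tree_kernel.
rewrite /tree_energy [leRHS]integral_mkcond; apply: ge0_integral_mono.
  by move=> p; rewrite lee_fin tree_kernel_ge0.
move=> p; have [->|k0] := eqVneq (tree_kernel w tau T p) 0.
  apply: erestrict_ge0 => {}p _; rewrite lee_fin.
  by apply: prodr_ge0 => l _; exact: sqr_ge0.
have [dom ->] := tree_kernel_support k0.
rewrite patchE mem_set//.
rewrite lee_fin le_eqVlt; apply/orP; left; apply/eqP.
rewrite big_seq [RHS]big_seq; apply: eq_bigr => l.
rewrite mem_filter => /andP[_ /dom[h1 h2 _]].
by rewrite wv ?h1// enorm_sqr.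
Qed.

Definition trees_integral w i t := \sum_(tau <- trees i) tree_integral w tau t.
Definition trees_density w i t := \sum_(tau <- trees i) tree_density w tau t.

Lemma trees_primitive T w i : L1 T w ->
  primitive T (trees_integral w i) (trees_density w i).
Proof. by move=> wi; apply: primitive_sum => tau _; exact: tree_primitive. Qed.

Lemma trees_integral_ge0 w i t : (forall x, 0 <= w x) -> 0 <= trees_integral w i t.
Proof. by move=> w0; apply: sumr_ge0 => tau _; exact: tree_integral_ge0. Qed.

Lemma trees_density1 w t : trees_density w 1 t = w t.
Proof. by rewrite /trees_density trees1 big_seq1. Qed.

(** The recursion on trees: splitting at the root turns the sum over the trees
    with [i] leaves into a Cauchy product. *)
Lemma trees_densityE w i t : (1 < i)%N -> trees_density w i t =
  \sum_(1 <= k < i) trees_integral w k t * trees_integral w (i - k) t.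
Proof.
move=> i1; rewrite /trees_density treesE// big_flatten big_map.
apply: eq_bigr => k _; rewrite big_allpairs_dep/= /trees_integral.
by rewrite big_distrlr.
Qed.

End trees.

(** * Series *)

Section series.
Context {R : realType}.
Local Notation mu := (@lebesgue_measure R).
Implicit Types T t e : R.

Lemma sum_triangle (V : zmodType) (f : nat -> nat -> V) k :
  \sum_(1 <= i < k) \sum_(1 <= l < i) f l (i - l)%N =
  \sum_(1 <= l < k) \sum_(1 <= j < k - l) f l j.
Proof.
elim: k => [|[|k] IH]; [by rewrite !big_geq|by rewrite !big_geq|].
rewrite big_nat_recr//= IH [RHS]big_nat_recr//= subSnn [X in _ = _ + X]big_geq// addr0.
rewrite -big_split; apply: eq_big_nat => l /andP[l1 lk] /=.
by rewrite [in RHS]subSn// ?big_nat_recr ?subn_gt0// ltnW.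
Qed.

(** The products that the partial Cauchy product omits have indices [l], [j] with
    [l + j >= k], hence not both below [k / 2]. *)
Lemma cauchy_product_dist n (z : nat -> 'cV[R]_n) (b : nat -> R) k
    (beta := fun k => \sum_(1 <= i < k) b i) (S := \sum_(1 <= i < k) z i) :
  (forall i, 0 <= b i) -> (forall i, (1 <= i)%N -> sumnorm (z i) <= b i) ->
  sumnorm (kron_cv S S - \sum_(1 <= i < k) \sum_(1 <= l < i) kron_cv (z l) (z (i - l)%N))
  <= beta k ^+ 2 - beta k./2 ^+ 2.
Proof.
move=> b0 zb; rewrite (sum_triangle (fun l j => kron_cv (z l) (z j))).
have beta_mono i j : (i <= j)%N -> beta i <= beta j.
  move=> ij; rewrite /beta; have [i1|i1] := leqP 1 i.
    by rewrite [leRHS](big_cat_nat (n := i))//= lerDl sumr_ge0.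
  by rewrite big_geq 1?ltnW// sumr_ge0.
have -> : kron_cv S S - \sum_(1 <= l < k) \sum_(1 <= j < k - l) kron_cv (z l) (z j) =
    \sum_(1 <= l < k) \sum_(k - l <= j < k) kron_cv (z l) (z j).
  rewrite {1}/S kron_cv_suml -sumrB; apply: eq_big_nat => l /andP[l1 lk].
  rewrite /S kron_cv_sumr [X in X - _](big_cat_nat (n := (k - l)%N)) ?subn_gt0 ?leq_subr//=.
  by rewrite addrC addrK.
apply: (@le_trans _ _ (\sum_(1 <= l < k) b l * (beta k - beta (k - l)%N))).
  rewrite big_nat [leRHS]big_nat.
  apply: (le_trans (sumnorm_sum _ _ _)); apply: ler_sum => l /andP[l1 lk].
  rewrite /beta (big_cat_nat (n := (k - l)%N) (m := 1))
    ?subn_gt0 ?leq_subr//= [X in _ <= _ * X]addrC addKr.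
  rewrite mulr_sumr big_nat [leRHS]big_nat.
  apply: (le_trans (sumnorm_sum _ _ _)); apply: ler_sum => j /andP[j1 jk].
  rewrite sumnorm_kron ler_pM ?sumnorm_ge0 ?zb// (leq_trans _ j1)// subn_gt0//.
have h2 : (k./2 <= k)%N by lia.
under eq_bigr do rewrite mulrBr.
rewrite sumrB -mulr_suml -/(beta k) -expr2 lerD2l lerN2.
have [k1|k1] := leqP 1 k./2; last first.
  by rewrite {1}/beta big_geq 1?ltnW// expr0n sumr_ge0// => l _; rewrite mulr_ge0// sumr_ge0.
rewrite [leRHS](big_cat_nat (n := k./2))//= -[leLHS]addr0.
apply: lerD; last by apply: sumr_ge0 => l _; rewrite mulr_ge0// sumr_ge0.
rewrite expr2 [X in X * _]/beta mulr_suml.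
apply: ler_sum_nat => l /andP[l1 lk]; rewrite ler_wpM2l// beta_mono//.
lia.
Qed.

Lemma partial_sums_le (b : nat -> R) (L : R) :
  (forall i, 0 <= b i) -> (fun k => \sum_(1 <= i < k) b i) @ \oo --> L ->
  forall k, \sum_(1 <= i < k) b i <= L.
Proof.
move=> b0 bL; set beta := fun k => _ in bL.
have bnd : nondecreasing_seq beta.
  apply/nondecreasing_seqP => -[|k]; first by rewrite /beta !big_geq.
  by rewrite /beta [leRHS]big_nat_recr//= lerDl.
move=> k; rewrite -/(beta k) -(cvg_lim _ bL)//.
by apply: nondecreasing_cvgn_le => //; apply: cvgP bL.
Qed.

(** The sequences [beta + S] and [beta - S] of partial sums are nondecreasing and
    bounded, hence below their limits. *)
Lemma normal_series1 (s b : nat -> R) (L : R) :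
  (forall i, (1 <= i)%N -> `|s i| <= b i) ->
  (fun k => \sum_(1 <= i < k) b i) @ \oo --> L ->
  exists x : R, forall k,
    `|x - \sum_(1 <= i < k) s i| <= L - \sum_(1 <= i < k) b i.
Proof.
move=> sb bL; set beta := fun k => _ in bL; pose S k := \sum_(1 <= i < k) s i.
have mono (c : R) : `|c| <= 1 -> nondecreasing_seq (fun k => beta k + c * S k).
  move=> c1; apply/nondecreasing_seqP => -[|k]; first by rewrite /beta /S !big_geq.
  rewrite /beta /S !(big_nat_recr k.+1)//= mulrDr addrACA lerDl.
  have : `|c * s k.+1| <= b k.+1.
    by rewrite normrM (le_trans _ (sb k.+1 isT))// ler_piMl.
  by rewrite ler_norml => /andP[+ _]; lra.
have beta_mono : nondecreasing_seq beta.
  have /mono : `|0 : R| <= 1 by rewrite normr0.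
  by under eq_fun do rewrite mul0r addr0.
have betaL k : beta k <= L.
  rewrite -(cvg_lim _ bL)//; apply: nondecreasing_cvgn_le => //; exact: cvgP bL.
have Sbeta k : `|S k| <= beta k.
  rewrite (le_trans (ler_norm_sum _ _ _))// /beta big_nat [leRHS]big_nat.
  by apply: ler_sum => i /andP[i1 _]; exact: sb.
have up : nondecreasing_seq (fun k => beta k + 1 * S k) by apply: mono; rewrite normr1.
have um : nondecreasing_seq (fun k => beta k + -1 * S k).
  by apply: mono; rewrite normrN1.
have cu : cvgn (fun k => beta k + 1 * S k).
  apply: nondecreasing_is_cvgn => //; exists (L + L) => _ [k _ <-].
  have := Sbeta k; have := betaL k; rewrite ler_norml => ? /andP[]; lra.
pose x := limn (fun k => beta k + 1 * S k) - L.
have cv : (fun k => beta k + -1 * S k) @ \oo --> L - x.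
  have -> : L - x = L + L - limn (fun k => beta k + 1 * S k) by rewrite /x; ring.
  rewrite (_ : (fun k => beta k + -1 * S k) =
      (fun k => beta k + beta k - (beta k + 1 * S k))).
    by apply: cvgB => //; exact: cvgD.
  by apply/funext => k; ring.
exists x => k; rewrite -/(S k) -/(beta k) ler_norml.
have := nondecreasing_cvgn_le up cu k; have := nondecreasing_cvgn_le um (cvgP _ cv) k.
rewrite (cvg_lim _ cv)// /x; move: (limn _) => l; lra.
Qed.

Lemma normal_series n (z : nat -> 'cV[R]_n) (b : nat -> R) (L : R) :
  (forall i, (1 <= i)%N -> sumnorm (z i) <= b i) ->
  (fun k => \sum_(1 <= i < k) b i) @ \oo --> L ->
  exists x : 'cV[R]_n, forall k,
    sumnorm (x - \sum_(1 <= i < k) z i) <= n%:R * (L - \sum_(1 <= i < k) b i).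
Proof.
move=> zb bL.
have H (j : 'I_n) : exists x : R, forall k,
    `|x - \sum_(1 <= i < k) z i j 0| <= L - \sum_(1 <= i < k) b i.
  by apply: normal_series1 bL => i i1; apply: le_trans (zb _ i1); exact: le_sumnorm.
have [x xP] := choice H; exists (\col_j x j) => k.
apply: (@le_trans _ _ (\sum_(j < n) (L - \sum_(1 <= i < k) b i))).
  apply: ler_sum => j _; rewrite big_ord1 !mxE summxE; exact: xP.
by rewrite sumr_const card_ord mulr_natl lexx.
Qed.

Lemma mx_cvg p q (S : nat -> 'M[R]_(p, q)) (x : 'M[R]_(p, q)) (d : nat -> R) :
  d @ \oo --> (0 : R) -> (forall k, sumnorm (x - S k) <= d k) -> S @ \oo --> x.
Proof.
move=> d0 Sd; apply/cvg_ballP => e e0.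
have : \forall k \near \oo, d k < e by apply: (cvgr_lt 0 d0).
apply: filterS => k dk; split=> // i j.
rewrite /ball /= (le_lt_trans _ dk)//; apply: le_trans (Sd k).
by have := le_sumnorm (x - S k) i j; rewrite !mxE.
Qed.

Lemma mx_cvg_coord p q (S : nat -> 'M[R]_(p, q)) (x : 'M[R]_(p, q)) i j :
  S @ \oo --> x -> (fun k => S k i j) @ \oo --> x i j.
Proof.
move=> Sx.
exact: (@cvg_comp _ _ _ S (fun M : 'M[R]_(p, q) => M i j) _ _ _ Sx
  (@coord_continuous _ p q i j x)).
Qed.

Lemma L1_dominated T (F : nat -> R -> R) (f g : R -> R) :
  (forall k, L1 T (F k)) -> L1 T g ->
  (forall k t, 0 <= t <= T -> `|F k t| <= g t) ->
  (forall t, 0 <= t <= T -> (fun k => F k t) @ \oo --> f t) ->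
  L1 T f /\ forall t, 0 <= t <= T ->
    (fun k => \int[mu]_(s in `[0, t]) F k s) @ \oo --> \int[mu]_(s in `[0, t]) f s.
Proof.
move=> Fi gi Fg Ff.
have H t : t <= T -> mu.-integrable `[0, t] (EFin \o f) /\
    (fun k => \int[mu]_(s in `[0, t]) F k s) @ \oo --> \int[mu]_(s in `[0, t]) f s.
  move=> tT.
  have mF k : measurable_fun `[0, t] (EFin \o F k).
    exact: measurable_int (L1S tT (Fi k)).
  have sub x : `[0, t]%classic x -> 0 <= x <= T.
    by rewrite /= in_itv /= => /andP[-> xt]; rewrite (le_trans xt).
  have Ff' x : `[0, t]%classic x -> (fun k => (EFin \o F k) x) @ \oo --> (EFin \o f) x.
    by move=> /sub xT; apply: (cvg_EFin _ (Ff _ xT)); exact: nearW.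
  have mf : measurable_fun `[0, t] (EFin \o f).
    exact: emeasurable_fun_cvg mF Ff'.
  have [] := dominated_convergence (mu := mu) (D := `[0, t]%classic) _ mF mf _
    (L1S tT gi) _ => //.
  - exact: aeW.
  - apply: aeW => x k /sub xT; rewrite lee_fin; exact: Fg.
  move=> fi _ cv; split=> //; apply: fine_cvg.
  by rewrite fineK//; apply: integrable_fin_num.
split; first exact: (H T (lexx _)).1.
by move=> t /andP[_ tT]; exact: (H t tT).2.
Qed.

End series.

(** * The Gramian dominates the subsystems *)

Lemma convolution_index (i j k : nat) : (i < j.+1)%N -> (1 <= k < i)%N ->
  [/\ (k < j)%N, (1 <= k)%N, (i - k < j)%N & (1 <= i - k)%N].
Proof. by move=> ? ?; split; lia. Qed.

Section system.
Context {R : realType}.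
Local Notation mu := (@lebesgue_measure R).
Variables (n m : nat) (T : R) (T0 : 0 < T).
Variables (A : 'M[R]_n) (B : 'M[R]_(n, m)) (N : 'M[R]_(n, m * n)) (H : 'M[R]_(n, n * n)).
Implicit Types t e : R.

Let T0' : 0 <= T := ltW T0.

Definition gramian_init (Z : nat -> R -> 'M[R]_n) i : 'M[R]_n :=
  if i == 1%N then B *m B^T else
  H *m (\sum_(1 <= k < i)
     mx_integral `[0, T] (Z k) *t mx_integral `[0, T] (Z (i - k)%N)) *m H^T.

Lemma gramian_family_solution Z i : gramian_family T A B N H Z -> (1 <= i)%N ->
  is_solution T (fun _ => gramian_op A N) (gramian_init Z i) (Z i).
Proof.
move=> [Z1 ZS]; rewrite leq_eqVlt => /predU1P[<-//|i2].
have iE : (i == 1%N) = false by rewrite gtn_eqF.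
by rewrite /gramian_init iE; exact: (ZS _ i2).
Qed.

(** The initial values are built from the earlier terms by Kronecker products,
    which preserve symmetry and positivity, and so does the flow. *)
Lemma gramian_family_psd Z : gramian_family T A B N H Z ->
  forall i, (1 <= i)%N ->
  [/\ (mx_integral `[0, T] (Z i))^T = mx_integral `[0, T] (Z i),
      psd (mx_integral `[0, T] (Z i)) & psd (gramian_init Z i)].
Proof.
move=> Zf i; have [j] := ubnP i; elim: j i => // j IH i ij i1.
have Zs := gramian_family_solution Zf i1.
have [Gs Gp] : (gramian_init Z i)^T = gramian_init Z i /\ psd (gramian_init Z i).
  rewrite /gramian_init; case: eqP => [_|/eqP iN1].
    split; first by rewrite trmx_mul trmxK.
    by move=> v; rewrite qform_outer dot_ge0.
  split.
    rewrite !trmx_mul trmxK mulmxA linear_sum /=; congr (_ *m _ *m _).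
    apply: eq_big_nat => k ki; rewrite trmx_tens.
    have [h1 h2 h3 h4] := convolution_index ij ki.
    by have [-> _ _] := IH _ h1 h2; have [-> _ _] := IH _ h3 h4.
  move=> v; rewrite qform_conj qform_sum big_nat; apply: sumr_ge0 => k ki.
  have [h1 h2 h3 h4] := convolution_index ij ki.
  have [Ps Pp _] := IH _ h1 h2; have [_ Qp _] := IH _ h3 h4.
  exact: psd_tens.
have [_ Zp] := solution_primitive T0' Zs.
split=> //.
- apply/matrixP => a b; rewrite !mxE; apply: eq_itg => s sT.
  by rewrite -[in LHS](gramian_flow_sym T0' Zs Gs sT) mxE.
- exact: gramian_int_psd T0' Zp (gramian_flow_psd T0' Zs Gp).
Qed.

Variables (u fu : R -> 'cV[R]_m) (u_L2 : is_L2 T u) (fu_L2 : is_L2 T fu).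
Variable x_ : nat -> R -> 'cV[R]_n.

Definition forcing i t : 'cV[R]_n :=
  if i == 1%N then B *m u t else
  H *m (\sum_(1 <= k < i) kron_cv (x_ k t) (x_ (i - k)%N t)).

Definition subrhs i t : 'cV[R]_n :=
  A *m x_ i t + N *m kron_cv (fu t) (x_ i t) + forcing i t.

Hypothesis x_1 : is_solution T
  (fun t y => A *m y + B *m u t + N *m kron_cv (fu t) y) 0 (x_ 1%N).
Hypothesis x_i : forall i, (2 <= i)%N -> is_solution T
  (fun t y => A *m y + N *m kron_cv (fu t) y
     + H *m (\sum_(1 <= k < i) kron_cv (x_ k t) (x_ (i - k)%N t))) 0 (x_ i).

Lemma subsystem_primitive i : (1 <= i)%N ->
  x_ i 0 = 0 /\ mx_primitive T (x_ i) (subrhs i).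
Proof.
rewrite leq_eqVlt => /predU1P[<-|i2].
  have [x0 xp] := solution_primitive T0' x_1; split=> // a b.
  apply: eq_primitive (xp a b) => // t _.
  by rewrite /subrhs /forcing /= addrAC.
have [x0 xp] := solution_primitive T0' (x_i i2); split=> // a b.
by apply: eq_primitive (xp a b) => // t _; rewrite /subrhs /forcing gtn_eqF.
Qed.

Let w s := dot (u s) (u s).
Let E := expR (\int[mu]_(s in `[0, T]) dot (fu s) (fu s)).
Let c i t := E ^+ (2 * i - 1) * trees_integral w i t.

(** This is [forced_estimate] with the weight [rho = sum_k c_k c_(i-k)].  By
    induction and [kron_dominated], the forcing term of the [i]-th equation is
    controlled by [rho] and by the initial value of [Z i]; and [c i] is [E] times
    the integral of [rho], by the recursion on trees. *)
Lemma subsystem_estimate Z : gramian_family T A B N H Z ->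
  forall i, (1 <= i)%N -> forall t, 0 <= t <= T -> forall v,
  dot v (x_ i t) ^+ 2 <= c i t * qform (mx_integral `[0, T] (Z i)) v.
Proof.
move=> Zf i; have [j] := ubnP i; elim: j i => // j IH i ij i1 t tT v.
have Zs := gramian_family_solution Zf i1.
have [Ps Pp Gp] := gramian_family_psd Zf i1.
have [x0 xp] := subsystem_primitive i1.
have wi : L1 T w := L2_L1 u_L2.
have w0 s : 0 <= w s := dot_ge0 (u s).
have cp k : primitive T (c k) (fun t => E ^+ (2 * k - 1) * trees_density w k t).
  exact: primitiveZ (trees_primitive k wi).
have c0 k s : 0 <= c k s by rewrite mulr_ge0 ?exprn_ge0 ?expR_ge0 ?trees_integral_ge0.
pose rho s := E ^+ (2 * i - 2) * trees_density w i s.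
have rhoi : L1 T rho by apply: L1Z; exact: (trees_primitive i wi).1.
have rhoE : (1 < i)%N -> forall s, rho s = \sum_(1 <= k < i) c k s * c (i - k)%N s.
  move=> i2 s; rewrite /rho trees_densityE// mulr_sumr; apply: eq_big_nat => k ki.
  rewrite /c mulrACA -exprD; congr (E ^+ _ * _); lia.
have rho0 s : 0 <= s <= T -> 0 <= rho s.
  move=> _; move: i1; rewrite leq_eqVlt => /predU1P[i1|i2].
    by rewrite /rho -i1 trees_density1 mulr_ge0.
  by rewrite rhoE// sumr_ge0// => k _; rewrite mulr_ge0.
have -> : c i t = E * \int[mu]_(s in `[0, t]) rho s.
  have /andP[_ tT'] := tT.
  have [_ tr] := primitiveZ (E ^+ (2 * i - 2)) (trees_primitive i wi).
  have tr0 : trees_integral w i 0 = 0.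
    by apply: big1 => tau _; rewrite tree_integralE itg0.
  have := tr t tT; rewrite tr0 mulr0 add0r => <-.
  rewrite mulrA -exprS; congr (E ^+ _ * _); lia.
apply: (forced_estimate T0' (L2_L1 fu_L2) rhoi rho0 xp x0 Zs Gp) => // s sT {}v.
rewrite /forcing /gramian_init; case: eqP => [i1'|/eqP iN1].
  rewrite /rho i1' trees_density1 mul1r qform_outer dot_mulmx mulrC.
  exact: dot_sqr_le.
have i2 : (1 < i)%N by rewrite ltn_neqAle eq_sym iN1.
rewrite rhoE// qform_conj qform_sum dot_mulmx dot_sumr.
rewrite big_nat [X in _ <= X * _]big_nat [X in _ <= _ * X]big_nat.
apply: sqr_sum_le => k /(convolution_index ij)[h1 h2 h3 h4].
- by rewrite mulr_ge0.
- have [Pks Pkp _] := gramian_family_psd Zf h2.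
  have [_ Qkp _] := gramian_family_psd Zf h4.
  exact: psd_tens.
have [Pks Pkp _] := gramian_family_psd Zf h2.
by apply: kron_dominated => // v'; exact: IH.
Qed.

(** The estimate along the coordinate vectors, with [amgm2] to separate the
    control from the Gramian. *)
Lemma subsystem_bound Z i t : gramian_family T A B N H Z -> (1 <= i)%N ->
  0 <= t <= T ->
  sumnorm (x_ i t) <= n%:R * c i T + \tr (mx_integral `[0, T] (Z i)).
Proof.
move=> Zf i1 tT; have /andP[t0 tT'] := tT.
have wi : L1 T w := L2_L1 u_L2.
have w0 s : 0 <= w s := dot_ge0 (u s).
have c0 s : 0 <= c i s by rewrite mulr_ge0 ?exprn_ge0 ?expR_ge0 ?trees_integral_ge0.
have ct : c i t <= c i T.
  rewrite ler_wpM2l ?exprn_ge0 ?expR_ge0//.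
  apply: (primitive_le (trees_primitive i wi)) => // s _.
  apply: sumr_ge0 => -[|l r] _ //=; by rewrite mulr_ge0 ?tree_integral_ge0.
have [_ Pp _] := gramian_family_psd Zf i1.
rewrite (_ : _ + _ = \sum_(a < n) (c i T + mx_integral `[0, T] (Z i) a a)); last first.
  by rewrite big_split /= sumr_const card_ord mulr_natl.
apply: ler_sum => a _; rewrite big_ord1.
have := subsystem_estimate Zf i1 tT (delta_mx a 0).
rewrite dot_delta /qform /bform dot_delta -colE mxE.
set P := mx_integral _ _ a a => est.
have P0 : 0 <= P.
  by have := Pp (delta_mx a 0); rewrite /qform /bform dot_delta -colE mxE.
have : 2 * `|x_ i t a 0| <= c i T + P.
  apply: amgm2 => //; rewrite real_normK ?num_real//.
  by apply: (le_trans est); rewrite ler_wpM2r.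
have := normr_ge0 (x_ i t a 0); have := c0 T; lra.
Qed.

(** In [subsystem_bound], the first part is dominated by the series of the
    controls, and the second one sums to the trace of the Gramian. *)
Lemma subsystem_summable :
  (exists P, is_gramian T A B N H P) -> (control_series T u fu < +oo)%E ->
  exists (b : nat -> R) (L : R), [/\ forall i, 0 <= b i,
    forall i t, (1 <= i)%N -> 0 <= t <= T -> sumnorm (x_ i t) <= b i &
    (fun k => \sum_(1 <= i < k) b i) @ \oo --> L].
Proof.
move=> [P [Z Zf ZP]] cs.
have w0 s : 0 <= w s := dot_ge0 (u s).
have c0 i : 0 <= c i T by rewrite mulr_ge0 ?exprn_ge0 ?expR_ge0 ?trees_integral_ge0.
pose tr i := \tr (mx_integral `[0, T] (Z i)).
have tr0 i : (1 <= i)%N -> 0 <= tr i.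
  move=> i1; have [_ Pp _] := gramian_family_psd Zf i1.
  apply: sumr_ge0 => a _.
  by have := Pp (delta_mx a 0); rewrite /qform /bform dot_delta -colE mxE.
have ccvg : cvgn (fun k => \sum_(1 <= i < k) c i T).
  have EE : expR (\int[mu]_(s in `[0, T]) (enorm (fu s) ^+ 2)) = E.
    by congr expR; apply: eq_itg => s _; exact: enorm_sqr.
  apply: nondecreasing_is_cvgn.
    apply/nondecreasing_seqP => -[|k]; first by rewrite !big_geq.
    by rewrite [leRHS]big_nat_recr//= lerDl.
  have tau0 tau : (0 <= tree_energy T u tau)%E.
    apply: integral_ge0 => p _; rewrite lee_fin.
    by apply: prodr_ge0 => l _; exact: sqr_ge0.
  have t0 i : (0 <= (E ^+ (2 * i - 1))%:E * \sum_(tau <- trees i) tree_energy T u tau)%E.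
    by rewrite mule_ge0 ?lee_fin ?exprn_ge0 ?expR_ge0// sume_ge0.
  have cs' : control_series T u fu \is a fin_num.
    rewrite ge0_fin_numE// /control_series EE; exact: nneseries_ge0.
  exists (fine (control_series T u fu)) => _ [k _ <-].
  rewrite -lee_fin fineK// /control_series EE.
  apply: le_trans (nneseries_lim_ge k (fun i _ _ => t0 i)).
  rewrite -sumEFin; apply: lee_sum => i _.
  rewrite EFinM lee_wpmul2l ?lee_fin ?exprn_ge0 ?expR_ge0//.
  rewrite /trees_integral -sumEFin; apply: lee_sum => tau _.
  exact: tree_integral_le_energy.
have trcvg : (fun k => \sum_(1 <= i < k) tr i) @ \oo --> \tr P.
  rewrite (_ : (fun k => _) =
      (fun k => \sum_a (\sum_(1 <= i < k) mx_integral `[0, T] (Z i)) a a)).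
    by apply: (cvg_big (op := +%R)) => [|a _]; [exact: add_continuous|exact: mx_cvg_coord].
  apply/funext => k; under [RHS]eq_bigr do rewrite summxE.
  by rewrite exchange_big.
exists (fun i => if i == 0%N then 0 else n%:R * c i T + tr i).
exists (n%:R * limn (fun k => \sum_(1 <= i < k) c i T) + \tr P); split.
- by move=> [|i] //; exact: addr_ge0 (mulr_ge0 (ler0n _ _) (c0 _)) (tr0 _ _).
- by move=> [|i] t // _ tT; exact: subsystem_bound.
- rewrite (_ : (fun k => _) = (fun k => n%:R * (\sum_(1 <= i < k) c i T) +
      \sum_(1 <= i < k) tr i)).
    by apply: cvgD => //; apply: cvgMr.
  apply/funext => k; rewrite mulr_sumr -big_split; apply: eq_big_nat => i /andP[i1 _].
  by rewrite gtn_eqF.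
Qed.

End system.

(** * The full system *)

Section full.
Context {R : realType}.
Local Notation mu := (@lebesgue_measure R).
Variables (n m : nat) (T : R) (T0 : 0 < T).
Variables (A : 'M[R]_n) (B : 'M[R]_(n, m)) (N : 'M[R]_(n, m * n)) (H : 'M[R]_(n, n * n)).
Variables (u fu : R -> 'cV[R]_m) (u_L2 : is_L2 T u) (fu_L2 : is_L2 T fu).
Implicit Types t e : R.

Let T0' : 0 <= T := ltW T0.

Definition full_rhs t (y : 'cV[R]_n) : 'cV[R]_n :=
  A *m y + B *m u t + N *m kron_cv (fu t) y + H *m kron_cv y y.

Lemma L2_sumnorm (v : R -> 'cV[R]_m) : is_L2 T v -> L1 T (fun t => sumnorm (v t)).
Proof.
move=> vL2; have [mv _] := vL2.
apply: L1_sum => i _; apply: L1_sum => j _.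
apply: (L1_le _ _ (L1D (L1_cst T 1) (L2_L1 vL2))).
  rewrite ord1; apply: measurableT_comp => //; exact: mv.
move=> t _; rewrite normr_id ord1.
have : `|v t i 0| ^+ 2 <= dot (v t) (v t).
  rewrite real_normK ?num_real// /dot (bigD1 i)//= -expr2 lerDl.
  by apply: sumr_ge0 => k _; rewrite -expr2 sqr_ge0.
have := sqr_ge0 (`|v t i 0| - 1); have := normr_ge0 (v t i 0); nra.
Qed.

Lemma kron_sqr_dist (x y : 'cV[R]_n) :
  sumnorm (kron_cv y y - kron_cv x x) <= (sumnorm y + sumnorm x) * sumnorm (y - x).
Proof.
have -> : kron_cv y y - kron_cv x x = kron_cv (y - x) y + kron_cv x (y - x).
  by rewrite kron_cvBl kron_cvBr addrA subrK.
apply: (le_trans (sumnormD _ _)); rewrite !sumnorm_kron; lra.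
Qed.

Lemma full_rhs_dist t x y : sumnorm (full_rhs t y - full_rhs t x) <=
  (sumnorm A + sumnorm N * sumnorm (fu t) + sumnorm H * (sumnorm y + sumnorm x)) * sumnorm (y - x).
Proof.
have -> : full_rhs t y - full_rhs t x = A *m (y - x) + N *m kron_cv (fu t) (y - x) +
    H *m (kron_cv y y - kron_cv x x).
  rewrite /full_rhs kron_cvBr !mulmxBr.
  by apply/matrixP => i j; rewrite !mxE; ring.
rewrite !mulrDl.
apply: (le_trans (sumnormD _ _)); apply: lerD.
  apply: (le_trans (sumnormD _ _)); apply: lerD; first exact: sumnormM.
  by apply: (le_trans (sumnormM _ _)); rewrite sumnorm_kron mulrA.
apply: (le_trans (sumnormM _ _)); rewrite -mulrA ler_wpM2l ?sumnorm_ge0//.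
exact: kron_sqr_dist.
Qed.

(** Solutions are bounded on [[0, T]], so along two of them the right-hand side
    is Lipschitz with an integrable constant, and Gronwall's lemma applies. *)
Lemma full_solution_unique x y : is_solution T full_rhs 0 x ->
  is_solution T full_rhs 0 y -> forall t, 0 <= t <= T -> y t = x t.
Proof.
move=> /(solution_primitive T0')[x0 xp] /(solution_primitive T0')[y0 yp] t tT.
have bnd z z' : mx_primitive T z z' ->
    exists2 c : R, 0 <= c & forall t, 0 <= t <= T -> sumnorm (z t : 'cV[R]_n) <= c.
  move=> /mx_primitive_bounded[c c0 zc]; exists (\sum_(i < n) \sum_(j < 1) c).
    by do 2 apply: sumr_ge0 => ? _.
  by move=> s sT; do 2 apply: ler_sum => ? _; exact: zc.
have [cx cx0 xc] := bnd _ _ xp; have [cy cy0 yc] := bnd _ _ yp.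
apply/eqP; rewrite -subr_eq0; apply/eqP.
pose k s := sumnorm A + sumnorm H * (cy + cx) + sumnorm N * sumnorm (fu s).
apply: (mx_gronwall (mx_primitiveB yp xp) (k := k) _ _ _ _ tT).
- by rewrite x0 y0 subrr.
- by apply: L1D; [exact: L1_cst|exact: L1Z (L2_sumnorm fu_L2)].
- by move=> s _; rewrite /k !(addr_ge0, mulr_ge0, sumnorm_ge0).
move=> s sT; apply: (le_trans (full_rhs_dist _ _ _)).
rewrite ler_wpM2r ?sumnorm_ge0// /k [leRHS]addrAC lerD2l.
by rewrite ler_wpM2l ?sumnorm_ge0// lerD// ?xc ?yc.
Qed.

Variable x_ : nat -> R -> 'cV[R]_n.
Hypothesis x_0 : forall i, (1 <= i)%N ->
  x_ i 0 = 0 /\ mx_primitive T (x_ i) (subrhs A B N H u fu x_ i).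
Variables (b : nat -> R) (L : R).
Hypothesis b_ge0 : forall i, 0 <= b i.
Hypothesis x_b : forall i t, (1 <= i)%N -> 0 <= t <= T -> sumnorm (x_ i t) <= b i.
Hypothesis b_L : (fun k => \sum_(1 <= i < k) b i) @ \oo --> L.

Let S k t := \sum_(1 <= i < k) x_ i t.
Let beta k := \sum_(1 <= i < k) b i.
Let F k t := \sum_(1 <= i < k) subrhs A B N H u fu x_ i t.
Let Q k t := \sum_(1 <= i < k) \sum_(1 <= l < i) kron_cv (x_ l t) (x_ (i - l)%N t).

Lemma sum_subrhs k t :
  F k.+2 t = A *m S k.+2 t + B *m u t + N *m kron_cv (fu t) (S k.+2 t) + H *m Q k.+2 t.
Proof.
rewrite /F /subrhs !big_split /= -!mulmx_sumr -kron_cv_sumr -/(S _ t).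
have -> : \sum_(1 <= i < k.+2) forcing B H u x_ i t = B *m u t + H *m Q k.+2 t.
  rewrite /Q [in LHS]big_ltn// [in RHS]big_ltn// [X in H *m (X + _)]big_geq// add0r.
  congr (_ + _); rewrite mulmx_sumr; apply: eq_big_nat => i /andP[i2 _].
  by rewrite /forcing gtn_eqF.
by apply/matrixP => i j; rewrite !mxE; ring.
Qed.

Lemma beta_le k : 0 <= beta k <= L.
Proof. by rewrite sumr_ge0//=; exact: partial_sums_le b_L k. Qed.

Lemma sumnorm_S k t : 0 <= t <= T -> sumnorm (S k t) <= beta k.
Proof.
move=> tT; apply: (le_trans (sumnorm_sum _ _ _)); rewrite big_nat /beta [leRHS]big_nat.
by apply: ler_sum => i /andP[i1 _]; exact: x_b.
Qed.

Lemma sumnorm_Q k t : 0 <= t <= T ->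
  sumnorm (kron_cv (S k t) (S k t) - Q k t) <= beta k ^+ 2 - beta k./2 ^+ 2.
Proof. by move=> tT; apply: cauchy_product_dist => // i i1; exact: x_b. Qed.

(** Dominated convergence in the integrated equation of the partial sums: their
    quadratic terms are partial Cauchy products, which converge to the square of
    the sum.  The partial sums are taken from [k.+2] on, where they contain the
    first equation, the only one with the term [B u]. *)
Lemma series_solution : exists x : R -> 'cV[R]_n,
  (forall t, 0 <= t <= T -> (fun k => S k t) @ \oo --> x t) /\
  is_solution T full_rhs 0 x.
Proof.
have Hx t : exists x : 'cV[R]_n, 0 <= t <= T -> forall k,
    sumnorm (x - S k t) <= n%:R * (L - beta k).
  have [tT|tT] := boolP (0 <= t <= T); last by exists 0.
  have [x xP] := normal_series (fun i i1 => x_b i1 tT) b_L.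
  by exists x.
have [x xP] := choice Hx; pose d k := n%:R * (L - beta k).
have d0 : d @ \oo --> (0 : R).
  have -> : 0 = n%:R * (L - L) :> R by rewrite subrr mulr0.
  by apply: cvgMr; apply: cvgB => //; exact: cvg_cst.
have xcv t : 0 <= t <= T -> (fun k => S k t) @ \oo --> x t.
  by move=> tT; apply: (mx_cvg d0) => k; exact: xP.
exists x; split=> //.
have L0 : 0 <= L by have := beta_le 0; case/andP; exact: le_trans.
pose M := n%:R * L + L.
have SL k t : 0 <= t <= T -> sumnorm (S k t) <= L.
  by move=> tT; apply: (le_trans (sumnorm_S k tT)); case/andP: (beta_le k).
have xL t : 0 <= t <= T -> sumnorm (x t) <= n%:R * L.
  by move=> tT; have := xP t tT 0%N; rewrite /S /beta !big_geq// !subr0.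
have Sp k : mx_primitive T (S k) (F k).
  move=> i j.
  apply: (@eq_primitive _ T (fun t => \sum_(1 <= l < k | (1 <= l < k)%N) x_ l t i j) _
     (fun t => \sum_(1 <= l < k | (1 <= l < k)%N) subrhs A B N H u fu x_ l t i j)).
  - by move=> t _; rewrite -big_nat summxE.
  - by move=> t _; rewrite -big_nat summxE.
  - by apply: primitive_sum => l /andP[l1 _]; exact: (x_0 l1).2.
have S0 k : S k 0 = 0.
  by rewrite /S big_nat big1// => i /andP[i1 _]; exact: (x_0 i1).1.
have rhs_cvg t : 0 <= t <= T -> (fun k => F k.+2 t) @ \oo --> full_rhs t (x t).
  move=> tT.
  pose a := sumnorm A + sumnorm N * sumnorm (fu t) + sumnorm H * M.
  pose del k := a * d k.+2 + sumnorm H * (beta k.+2 ^+ 2 - beta k.+2./2 ^+ 2).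
  have del0 : del @ \oo --> (0 : R).
    have -> : 0 = a * 0 + sumnorm H * (L ^+ 2 - L ^+ 2) :> R by rewrite subrr !mulr0 addr0.
    have d2 : (fun k => d k.+2) @ \oo --> (0 : R).
      by have := d0; rewrite -(cvg_shiftn 2); under eq_fun do rewrite addn2.
    have b2 : (fun k => beta k.+2) @ \oo --> L.
      by have := b_L; rewrite -(cvg_shiftn 2); under eq_fun do rewrite addn2.
    have bh : (fun k => beta k.+2./2) @ \oo --> L.
      apply: (@cvg_comp _ _ _ (fun k : nat => k.+2./2) beta _ \oo _ _ b_L).
      move=> P [N0 _ NP]; exists N0.*2 => // k /= Nk; apply: NP => /=; lia.
    apply: cvgD; first exact: cvgMr.
    by apply: cvgMr; apply: cvgB; rewrite !expr2; apply: cvgM.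
  apply: (mx_cvg del0) => k.
  have -> : full_rhs t (x t) - F k.+2 t = (full_rhs t (x t) - full_rhs t (S k.+2 t)) +
      H *m (kron_cv (S k.+2 t) (S k.+2 t) - Q k.+2 t).
    rewrite sum_subrhs /full_rhs mulmxBr.
    by apply/matrixP => i j; rewrite !mxE; ring.
  apply: (le_trans (sumnormD _ _)); apply: lerD.
    apply: (le_trans (full_rhs_dist _ _ _)).
    apply: ler_pM; rewrite ?sumnorm_ge0 ?(addr_ge0, mulr_ge0, sumnorm_ge0)//; last exact: xP.
    by rewrite lerD2l ler_wpM2l ?sumnorm_ge0// lerD ?xL ?SL.
  apply: (le_trans (sumnormM _ _)); rewrite ler_wpM2l ?sumnorm_ge0//; exact: sumnorm_Q.
pose g t := sumnorm A * L + sumnorm H * (2 * L ^+ 2) + sumnorm B * sumnorm (u t) +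
   sumnorm N * L * sumnorm (fu t).
have gi : L1 T g.
  apply: L1D; last exact: L1Z (L2_sumnorm fu_L2).
  by apply: L1D; [exact: L1_cst|exact: L1Z (L2_sumnorm u_L2)].
have Fg k t i j : 0 <= t <= T -> `|F k.+2 t i j| <= g t.
  move=> tT; apply: (le_trans (le_sumnorm _ _ _)); rewrite sum_subrhs.
  have SLk := SL k.+2 t tT; have Sn0 := sumnorm_ge0 (S k.+2 t).
  have QL : sumnorm (Q k.+2 t) <= 2 * L ^+ 2.
    rewrite -[Q k.+2 t](subKr (kron_cv (S k.+2 t) (S k.+2 t))).
    apply: (le_trans (sumnormD _ _)); rewrite sumnormN sumnorm_kron.
    have := sumnorm_Q k.+2 tT; have /andP[b0 bL] := beta_le k.+2.
    have := sqr_ge0 (beta k.+2./2); nra.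
  have h1 := sumnormM A (S k.+2 t); have h2 := sumnormM B (u t).
  have h3 := sumnormM N (kron_cv (fu t) (S k.+2 t)); rewrite sumnorm_kron in h3.
  have h4 := sumnormM H (Q k.+2 t).
  have k1 : sumnorm A * sumnorm (S k.+2 t) <= sumnorm A * L by rewrite ler_wpM2l ?sumnorm_ge0.
  have k3 : sumnorm N * (sumnorm (fu t) * sumnorm (S k.+2 t)) <= sumnorm N * L * sumnorm (fu t).
    by rewrite -mulrA ler_wpM2l ?sumnorm_ge0// mulrC ler_wpM2r ?sumnorm_ge0.
  have k4 : sumnorm H * sumnorm (Q k.+2 t) <= sumnorm H * (2 * L ^+ 2).
    by rewrite ler_wpM2l ?sumnorm_ge0.
  have := sumnormD (A *m S k.+2 t + B *m u t + N *m kron_cv (fu t) (S k.+2 t)) (H *m Q k.+2 t).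
  have := sumnormD (A *m S k.+2 t + B *m u t) (N *m kron_cv (fu t) (S k.+2 t)).
  have := sumnormD (A *m S k.+2 t) (B *m u t).
  rewrite /g; lra.
have dom i j := L1_dominated (fun k => (Sp k.+2 i j).1) gi
  (fun k t => @Fg k t i j) (fun t tT => mx_cvg_coord (i := i) (j := j) (rhs_cvg t tT)).
split=> [i j|t tT]; first exact: (dom i j).1.
apply/matrixP => i j; rewrite !mxE add0r.
have cv1 := (dom i j).2 t tT.
have cv2 : (fun k => S k.+2 t i j) @ \oo --> x t i j.
  have := mx_cvg_coord (i := i) (j := j) (xcv t tT).
  by rewrite -(cvg_shiftn 2); under eq_fun do rewrite addn2.
apply: (cvg_unique _ cv2); first exact: norm_hausdorff.
have E k : \int[mu]_(s in `[0, t]) F k.+2 s i j = S k.+2 t i j.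
  by rewrite (Sp k.+2 i j).2// S0 mxE add0r.
by move: cv1; under eq_fun do rewrite E.
Qed.

End full.

Theorem corollary2p14 (R : realType) (n m : nat) (T : R) (T_gt0 : 0 < T)
    (A : 'M[R]_n) (B : 'M[R]_(n, m)) (N : 'M[R]_(n, m * n))
    (H : 'M[R]_(n, n * n))
    (gramian_exists : exists P : 'M[R]_n, is_gramian T A B N H P)
    (u fu : R -> 'cV[R]_m) (u_L2 : is_L2 T u) (fu_L2 : is_L2 T fu)
    (u_bound : (control_series T u fu < +oo)%E)
    (x_ : nat -> R -> 'cV[R]_n)
    (x_1 : is_solution T
       (fun t y => A *m y + B *m u t + N *m kron_cv (fu t) y) 0 (x_ 1%N))
    (x_i : forall i, (2 <= i)%N ->
       is_solution T
         (fun t y => A *m y + N *m kron_cv (fu t) y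
            + H *m (\sum_(1 <= k < i) kron_cv (x_ k t) (x_ (i - k)%N t)))
         0 (x_ i)) :
  let full_rhs := fun t y =>
    A *m y + B *m u t + N *m kron_cv (fu t) y + H *m kron_cv y y in
  exists x : R -> 'cV[R]_n,
    [/\ forall t, 0 <= t <= T -> (fun k => \sum_(1 <= i < k) x_ i t) @ \oo --> x t,
        is_solution T full_rhs 0 x
      & forall y : R -> 'cV[R]_n, is_solution T full_rhs 0 y ->
          forall t, 0 <= t <= T -> y t = x t].
Proof.
have [b [L [b0 xb bL]]] :=
  subsystem_summable T_gt0 u_L2 fu_L2 x_1 x_i gramian_exists u_bound.
have xp := subsystem_primitive T_gt0 x_1 x_i.
have [x [xcv xs]] := series_solution T_gt0 u_L2 fu_L2 xp b0 xb bL.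
move=> rhs; exists x; split=> // y ys.
exact: (full_solution_unique T_gt0 fu_L2 xs ys).
Qed.
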